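(* Let $\alpha\ge0$, $0\le\beta<1$, and $f=h+\overline{g}\in\mathcal{W}_{\mathcal{H}}^0(\alpha,\beta)$. (i) For $q>2$, $s_{2,q}(f)$ is a convex harmonic mapping in the disk $|z|<R_1$, where $R_1$ is the smallest positive root in $(0,1)$ of $$1-4r+(6\beta-2)r^2-8(1-\beta)r^3+(1-2\beta)r^4+4(1-\beta)r^5=0.$$ (ii) For $p>2$, $s_{p,2}(f)$ is a convex harmonic mapping in the disk $|z|<R_2$, where $R_2$ is the smallest positive root in $(0,1)$ of $$1-4r+(1-\beta)r^2-(8-3\beta)r^3-(5-2\beta)r^4-(4-3\beta)r^5+3(1-\beta)r^6=0.$$
   Context: Let $\mathbb{D}=\{z\in\mathbb{C}:|z|<1\}$. $\mathcal{H}^0$ denotes the class of harmonic maps $f=h+\overline{g}$ on $\mathbb{D}$, with $h,g$ analytic in $\mathbb{D}$, $h(z)=z+\sum_{n\ge2}a_nz^n$ and $g(z)=\sum_{n\ge2}b_nz^n$. For $\alpha\ge0$, $0\le\beta<1$, $\mathcal{W}_{\mathcal{H}}^0(\alpha,\beta)$ denotes the class of $f=h+\overline{g}\in\mathcal{H}^0$ such that $\Re\big(h'(z)+\alpha zh''(z)-\beta\big)>|g'(z)+\alpha zg''(z)|$ for all $z\in\mathbb{D}$. For integers $p,q\ge1$, $s_{p,q}(f)=s_p(h)+\overline{s_q(g)}$ with $s_p(h)(z)=z+\sum_{k=2}^pa_kz^k$ and $s_q(g)(z)=\sum_{k=2}^qb_kz^k$. A harmonic map is convex in a disk if it is univalent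 there and maps the disk onto a convex domain. *)

(* Defs.v *)
From Stdlib Require Import Reals Lra.
Open Scope R_scope.

Definition Cx : Type := (R * R)%type.
Definition RtoC (x : R) : Cx := (x, 0).
Definition Cre (z : Cx) : R := fst z.
Definition Cim (z : Cx) : R := snd z.
Definition Cadd (z w : Cx) : Cx := (fst z + fst w, snd z + snd w).
Definition Copp (z : Cx) : Cx := (- fst z, - snd z).
Definition Csub (z w : Cx) : Cx := Cadd z (Copp w).
Definition Cmul (z w : Cx) : Cx :=
  (fst z * fst w - snd z * snd w, fst z * snd w + snd z * fst w).
Definition Cconj (z : Cx) : Cx := (fst z, - snd z).
Definition Cmod (z : Cx) : R := sqrt (fst z * fst z + snd z * snd z).
Definition Cinv (z : Cx) : Cx :=
  (fst z / (fst z * fst z + snd z * snd z), - snd z / (fst z * fst z + snd z * snd z)).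
Definition Cdiv (z w : Cx) : Cx := Cmul z (Cinv w).
Definition Cscal (r : R) (z : Cx) : Cx := (r * fst z, r * snd z).
Fixpoint Cpow (z : Cx) (n : nat) : Cx :=
  match n with O => (1, 0) | S m => Cmul z (Cpow z m) end.

Fixpoint Csum_upto (F : nat -> Cx) (n : nat) : Cx :=
  match n with O => F O | S m => Cadd (Csum_upto F m) (F (S m)) end.
Definition Csum (m n : nat) (F : nat -> Cx) : Cx :=
  Csum_upto (fun k => if Nat.leb m k then if Nat.leb k n then F k else (0,0) else (0,0)) n.

Definition Cderiv_at (f : Cx -> Cx) (z l : Cx) : Prop :=
  forall eps : R, 0 < eps -> exists del : R, 0 < del /\
    forall w : Cx, 0 < Cmod w < del ->
      Cmod (Csub (Cdiv (Csub (f (Cadd z w)) (f z)) w) l) < eps.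

Definition inD (z : Cx) : Prop := Cmod z < 1.

(** The class H^0: h(z) = z + sum_{n>=2} a_n z^n and g(z) = sum_{n>=2} b_n z^n,
    the series converging (to h, g) at every point of the unit disk; in particular
    h and g are analytic in D.  Only a_n, b_n for n >= 2 are used. *)
Definition series_conv_to (P : nat -> Cx) (l : Cx) : Prop :=
  forall eps : R, 0 < eps -> exists N : nat, forall n : nat, (N <= n)%nat ->
    Cmod (Csub (P n) l) < eps.

Definition in_H0 (a b : nat -> Cx) (h g : Cx -> Cx) : Prop :=
  forall z : Cx, inD z ->
    series_conv_to (fun n => Cadd z (Csum 2 n (fun k => Cmul (a k) (Cpow z k)))) (h z) /\
    series_conv_to (fun n => Csum 2 n (fun k => Cmul (b k) (Cpow z k))) (g z).

(** The class W_H^0(alpha, beta):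
    Re (h' + alpha z h'' - beta) > | g' + alpha z g'' | on D.
    h1, h2 (resp. g1, g2) are the first and second complex derivatives of h (resp. g)
    on D (they are unique on the open disk). *)
Definition in_WH0 (alpha beta : R) (a b : nat -> Cx) (h g : Cx -> Cx) : Prop :=
  in_H0 a b h g /\
  exists h1 h2 g1 g2 : Cx -> Cx,
    (forall z, inD z ->
       Cderiv_at h z (h1 z) /\ Cderiv_at h1 z (h2 z) /\
       Cderiv_at g z (g1 z) /\ Cderiv_at g1 z (g2 z)) /\
    (forall z, inD z ->
       Cre (Csub (Cadd (h1 z) (Cmul (RtoC alpha) (Cmul z (h2 z)))) (RtoC beta))
       > Cmod (Cadd (g1 z) (Cmul (RtoC alpha) (Cmul z (g2 z))))).

Definition s_sec (a : nat -> Cx) (p : nat) (z : Cx) : Cx :=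
  Cadd z (Csum 2 p (fun k => Cmul (a k) (Cpow z k))).
Definition s_sec0 (b : nat -> Cx) (q : nat) (z : Cx) : Cx :=
  Csum 2 q (fun k => Cmul (b k) (Cpow z k)).
Definition s_pq (a b : nat -> Cx) (p q : nat) (z : Cx) : Cx :=
  Cadd (s_sec a p z) (Cconj (s_sec0 b q z)).

Definition convex_in_disk (F : Cx -> Cx) (r : R) : Prop :=
  (forall z w : Cx, Cmod z < r -> Cmod w < r -> F z = F w -> z = w) /\
  (forall z w : Cx, Cmod z < r -> Cmod w < r -> forall t : R, 0 <= t <= 1 ->
     exists u : Cx, Cmod u < r /\
       F u = Cadd (Cscal (1 - t) (F z)) (Cscal t (F w))).

Definition P1 (beta r : R) : R :=
  1 - 4 * r + (6 * beta - 2) * r ^ 2 - 8 * (1 - beta) * r ^ 3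
  + (1 - 2 * beta) * r ^ 4 + 4 * (1 - beta) * r ^ 5.
Definition P2 (beta r : R) : R :=
  1 - 4 * r + (1 - beta) * r ^ 2 - (8 - 3 * beta) * r ^ 3
  - (5 - 2 * beta) * r ^ 4 - (4 - 3 * beta) * r ^ 5 + 3 * (1 - beta) * r ^ 6.

Definition smallest_root_01 (P : R -> R) (R0 : R) : Prop :=
  0 < R0 < 1 /\ P R0 = 0 /\ (forall r : R, 0 < r < R0 -> P r <> 0).

(* Main.v *)
(** Write gamma = 1 - beta.  On every ray Re (h' + e g') - beta is positive at
    its minimum, because there the radial derivative multiplied by alpha has
    the favourable sign; hence |g'| <= Re h' - beta on D and alpha disappears.
    Averaging this positive function over roots of unity against nonnegative
    trigonometric polynomials yields linear inequalities for the coefficients,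
    in particular k (|a_k| + |b_k|) <= 2 gamma and k |b_k| <= gamma.

    A section f, whose analytic and anti-analytic parts have derivatives A and
    conj B, is convex because the analytic functions F with F' = A + e B,
    |e| = 1, satisfy Re (2 F' + z F'') >= |z F''| on circles, a linear
    strengthening of Re (1 + z F''/F') >= 0.  The tangent of the image of a
    circle then turns monotonically, so that this image has a supporting line
    at each of its points.  Since f - id is a contraction on the disk, f
    extends to a bijection of the plane that maps points outside the disk
    beyond a supporting line.

    The criterion for the sections is linear in the coefficients.  Its terms
    of order at least 4 are bounded in absolute value; those of order 2 and 3
    need the inequality given by a suitable trigonometric polynomial, because
    the coefficient bounds alone are too weak when beta is small. *)

(* The polynomials of the statement enter only through the position of their roots. The smallest
   root of [P2] never exceeds 234/1000, so for (ii) one estimate on that disk, uniform in beta, is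
   enough. The root of [P1] grows from about 0.21 at beta = 0 towards sqrt 2 - 1 as beta tends to 1,
   so (i) has two regimes: up to 23/100 an estimate uniform in gamma, and beyond it the equation
   itself, which makes gamma so small that the coefficient bounds suffice.

   The convexity criterion is a family of real linear inequalities in the coefficients, and a
   positive real part yields information of exactly this kind: a trigonometric polynomial whose
   pairing with the coefficients reproduces the criterion proves it once it is nonnegative. The
   obstacle is that this information concerns a_3 + e b_3, whereas each section lacks one of the two
   coefficients. Separating them costs 6 r^2 gamma, the origin of the term 6 r^2 in both
   polynomials. *)
Require Import Defs.
From Stdlib Require Import Reals Arith Lra Lia.
From Coquelicot Require Import Coquelicot.
Open Scope R_scope.

(* Sums computed by [sum_n] live in [C_AbelianMonoid], which [ring] does not recognize. *)
Ltac cring := match goal with |- @eq _ ?x ?y => change (@eq C x y); ring end.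

(** * Finite sums, moduli and powers of complex numbers *)

Lemma sum_n_SC (F : nat -> C) (n : nat) :
  sum_n F (S n) = (sum_n F n + F (S n))%C.
Proof. exact (sum_Sn F n). Qed.

Lemma sum_n_SR (F : nat -> R) (n : nat) :
  sum_n F (S n) = sum_n F n + F (S n).
Proof. exact (sum_Sn F n). Qed.

Lemma sum_n_ext_C (F G : nat -> C) (n : nat) :
  (forall k, F k = G k) -> sum_n F n = sum_n G n.
Proof. exact (sum_n_ext (G := C_AbelianMonoid) F G n). Qed.

Lemma sum_n_ext_R (F G : nat -> R) (n : nat) :
  (forall k, F k = G k) -> sum_n F n = sum_n G n.
Proof. exact (sum_n_ext (G := R_AbelianMonoid) F G n). Qed.

Lemma sum_n_plus_R (F G : nat -> R) (n : nat) :
  sum_n (fun k => F k + G k) n = sum_n F n + sum_n G n.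
Proof. exact (sum_n_plus (G := R_AbelianMonoid) F G n). Qed.

Lemma sum_n_nonneg (u : nat -> R) (n : nat) :
  (forall k, (k <= n)%nat -> 0 <= u k) -> 0 <= sum_n u n.
Proof.
  induction n as [|n IH]; intros H.
  - rewrite sum_O. apply H; lia.
  - rewrite sum_n_SR. apply Rplus_le_le_0_compat; [apply IH; intros; apply H; lia | apply H; lia].
Qed.

Lemma sum_n_scal_R (c : R) (u : nat -> R) (n : nat) :
  sum_n (fun k => c * u k) n = c * sum_n u n.
Proof. exact (sum_n_mult_l (K := R_Ring) c u n). Qed.

Lemma sum_n_scal_C (c : C) (F : nat -> C) (n : nat) :
  sum_n (fun k => c * F k)%C n = (c * sum_n F n)%C.
Proof. exact (sum_n_mult_l (K := C_Ring) c F n). Qed.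

Lemma sum_n_plus_C (F G : nat -> C) (n : nat) :
  sum_n (fun k => F k + G k)%C n = (sum_n F n + sum_n G n)%C.
Proof. exact (sum_n_plus (G := C_AbelianMonoid) F G n). Qed.

Lemma Cmod_sum_n (F : nat -> C) (u : nat -> R) (n : nat) :
  (forall k, (k <= n)%nat -> Cmod (F k) <= u k) -> Cmod (sum_n F n) <= sum_n u n.
Proof.
  induction n as [|n IH]; intros H.
  - rewrite !sum_O. apply H; lia.
  - rewrite sum_n_SR, sum_n_SC. eapply Rle_trans; [apply Cmod_triangle|].
    apply Rplus_le_compat; [apply IH; intros; apply H; lia | apply H; lia].
Qed.

Lemma Re_sum_n (F : nat -> C) (n : nat) :
  Re (sum_n F n) = sum_n (fun k => Re (F k)) n.
Proof.
  induction n as [|n IH]; [now rewrite !sum_O|].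
  now rewrite sum_n_SR, sum_n_SC, re_plus, IH.
Qed.

Lemma Cconj_sum_n (F : nat -> C) (n : nat) :
  Cconj (sum_n F n) = sum_n (fun k => Cconj (F k)) n.
Proof.
  induction n as [|n IH]; [now rewrite !sum_O|].
  now rewrite !sum_n_SC, Cplus_conj, IH.
Qed.

Lemma re_minus (x y : C) : Re (x - y) = Re x - Re y.
Proof. unfold Cminus. rewrite re_plus, re_opp. ring. Qed.

Lemma im_minus (x y : C) : Im (x - y) = Im x - Im y.
Proof. unfold Cminus. rewrite im_plus, im_opp. ring. Qed.

Lemma C_ext (x y : C) : Re x = Re y -> Im x = Im y -> x = y.
Proof. destruct x, y; simpl; intros; subst; reflexivity. Qed.

Lemma Cmod_minus_sym (x y : C) : Cmod (x - y) = Cmod (y - x).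
Proof. rewrite <- Cmod_opp. f_equal. ring. Qed.

Lemma re_le (x : C) : Re x <= Cmod x.
Proof. eapply Rle_trans; [apply Rle_abs | apply re_le_Cmod]. Qed.

Lemma re_ge (x : C) : - Cmod x <= Re x.
Proof. pose proof (re_le (- x)%C). rewrite re_opp, Cmod_opp in H. lra. Qed.

Lemma im_abs_le (x : C) : Rabs (Im x) <= Cmod x.
Proof. eapply Rle_trans; [apply Rmax_r | apply Rmax_Cmod]. Qed.

Lemma Cmod_sub_triangle (x y z : C) : Cmod (x - z) <= Cmod (x - y) + Cmod (y - z).
Proof. replace (x - z)%C with ((x - y) + (y - z))%C by ring. apply Cmod_triangle. Qed.

Lemma Cmod_RtoC_mult (c : R) (z : C) : Cmod (RtoC c * z) = Rabs c * Cmod z.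
Proof. now rewrite Cmod_mult, Cmod_R. Qed.

Lemma Cmod_INR_mult (k : nat) (z : C) : Cmod (RtoC (INR k) * z) = INR k * Cmod z.
Proof. rewrite Cmod_RtoC_mult, Rabs_pos_eq; [reflexivity | apply pos_INR]. Qed.

Lemma Cmod_pow_le (z : C) (r : R) (n : nat) : Cmod z <= r -> Cmod (z ^ n)%C <= r ^ n.
Proof. intros H. rewrite Cmod_pow. apply pow_incr. split; [apply Cmod_ge_0 | exact H]. Qed.

(** This turns bounds on k |c_k| r^(k-1) into Lipschitz constants, both for the perturbation of the
    identity and for tails of power series. *)
Lemma Cmod_pow_sub (z w : C) (r : R) (n : nat) :
  Cmod z <= r -> Cmod w <= r ->
  Cmod (z ^ n - w ^ n)%C <= INR n * r ^ pred n * Cmod (z - w).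
Proof.
  intros Hz Hw. assert (Hr : 0 <= r) by (eapply Rle_trans; [apply Cmod_ge_0 | exact Hz]).
  induction n as [|n IH].
  - simpl. replace (1 - 1)%C with (RtoC 0) by ring. rewrite Cmod_0. lra.
  - replace (z ^ S n - w ^ S n)%C with (z * (z ^ n - w ^ n) + w ^ n * (z - w))%C
      by (rewrite !Cpow_S; ring).
    eapply Rle_trans; [apply Cmod_triangle|]. rewrite !Cmod_mult.
    assert (Hn : Cmod z * Cmod (z ^ n - w ^ n)%C <= INR n * r ^ n * Cmod (z - w)).
    { apply Rle_trans with (r * (INR n * r ^ pred n * Cmod (z - w))).
      - apply Rmult_le_compat; auto using Cmod_ge_0.
      - destruct n as [|n]; simpl; [lra | apply Req_le; ring]. }
    assert (Cmod (w ^ n)%C * Cmod (z - w) <= r ^ n * Cmod (z - w))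
      by (apply Rmult_le_compat_r; [apply Cmod_ge_0 | now apply Cmod_pow_le]).
    rewrite S_INR. simpl pred. lra.
Qed.

(** A modulus is the real part after a rotation; through this, inequalities with a modulus are
    exchanged for families of linear ones. *)
Lemma unit_direction (x : C) : exists e : C, Cmod e = 1 /\ (e * x)%C = RtoC (Cmod x).
Proof.
  destruct (Ceq_dec x 0) as [-> | Hx].
  - exists 1%C. rewrite Cmod_0, Cmod_1. split; [reflexivity | ring].
  - assert (Hm : 0 < Cmod x) by now apply Cmod_gt_0.
    assert (Hc : RtoC (Cmod x) <> 0%C) by (intros E; apply RtoC_inj in E; lra).
    exists (Cconj x / RtoC (Cmod x))%C. split.
    + rewrite Cmod_div by exact Hc. rewrite Cmod_conj, Cmod_R, Rabs_pos_eq by lra. field. lra.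
    + transitivity ((x * Cconj x) / RtoC (Cmod x))%C; [now field|].
      rewrite <- Cmod2_conj, RtoC_pow. now field.
Qed.

(** * Points of the unit circle and polar form *)

Definition cis (t : R) : C := (cos t, sin t).

Lemma Cmod_cis (t : R) : Cmod (cis t) = 1.
Proof.
  unfold Cmod, cis; simpl. transitivity (sqrt 1); [f_equal | apply sqrt_1].
  pose proof (sin2_cos2 t). unfold Rsqr in H. lra.
Qed.

Lemma cis_add (s t : R) : cis (s + t) = (cis s * cis t)%C.
Proof.
  apply C_ext; unfold cis; simpl; [rewrite cos_plus | rewrite sin_plus]; ring.
Qed.

Lemma cis_0 : cis 0 = 1%C.
Proof. unfold cis. now rewrite cos_0, sin_0. Qed.

Lemma cis_2PI (t : R) : cis (t + 2 * PI) = cis t.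
Proof.
  unfold cis. rewrite sin_plus, cos_plus, sin_2PI, cos_2PI. f_equal; ring.
Qed.

Lemma cis_pow (t : R) (n : nat) : (cis t ^ n)%C = cis (INR n * t).
Proof.
  induction n as [|n IH].
  - simpl. now rewrite Rmult_0_l, cis_0.
  - rewrite Cpow_S, IH, <- cis_add, S_INR. f_equal. ring.
Qed.

Lemma cis_conj_mult (t : R) : (Cconj (cis t) * cis t)%C = 1%C.
Proof. rewrite Cmult_comm, <- Cmod2_conj, Cmod_cis, RtoC_pow. ring. Qed.

Lemma unit_polar (x : C) : Cmod x = 1 -> exists t, 0 <= t <= 2 * PI /\ x = cis t.
Proof.
  intros H. assert (H2 : Re x ^ 2 + Im x ^ 2 = 1) by (rewrite <- Cmod2_alt, H; ring).
  destruct x as [a b]; simpl in H2.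
  assert (Ha : -1 <= a <= 1) by nra.
  pose proof (acos_bound a) as Hb. pose proof PI_RGT_0.
  assert (Hs : sqrt (1 - Rsqr a) = Rabs b).
  { rewrite <- (sqrt_Rsqr_abs b). f_equal. unfold Rsqr. lra. }
  destruct (Rle_dec 0 b) as [Hpos | Hneg].
  - exists (acos a). split; [lra|]. unfold cis.
    rewrite cos_acos, sin_acos, Hs, Rabs_pos_eq by lra. reflexivity.
  - exists (- acos a + 2 * PI). split; [lra|]. rewrite cis_2PI. unfold cis.
    rewrite cos_neg, sin_neg, cos_acos, sin_acos, Hs, Rabs_left by lra. f_equal; ring.
Qed.

(** The angle is taken in the period that starts at [t0], because values on the circle are compared
    with the value at [t0] over one turn. *)
Lemma polar_from (z : C) (r t0 : R) :
  0 < r -> Cmod z = r -> exists t, t0 <= t <= t0 + 2 * PI /\ z = (RtoC r * cis t)%C.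
Proof.
  intros Hr Hz.
  assert (Hc : RtoC r <> 0%C) by (intros E; apply RtoC_inj in E; lra).
  destruct (unit_polar (z / RtoC r * cis (- t0))%C) as [t [Ht E]].
  { rewrite Cmod_mult, Cmod_cis, Cmod_div, Cmod_R, Hz, Rabs_pos_eq by (auto; lra). field. lra. }
  exists (t0 + t). split; [lra|]. rewrite cis_add, <- E.
  transitivity (z * (cis t0 * cis (- t0)))%C; [|field; auto].
  rewrite <- cis_add, Rplus_opp_r, cis_0. ring.
Qed.

Lemma le_of_is_derive (f df : R -> R) (a b : R) :
  a <= b -> (forall x, a <= x <= b -> is_derive f x (df x)) ->
  (forall x, a <= x <= b -> 0 <= df x) -> f a <= f b.
Proof.
  intros Hab Hd Hpos.
  destruct (MVT_gen f a b df) as [c [Hc E]].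
  - rewrite Rmin_left, Rmax_right by lra. intros x Hx. apply Hd. lra.
  - rewrite Rmin_left, Rmax_right by lra. intros x Hx.
    apply derivable_continuous_pt. exists (df x). now apply is_derive_Reals, Hd.
  - rewrite Rmin_left, Rmax_right in Hc by lra.
    assert (0 <= df c * (b - a)) by (apply Rmult_le_pos; [apply Hpos |]; lra). lra.
Qed.

(** * Supporting lines of the image of a circle *)

Section PolarDerivatives.

Variable r : R.

Let zt (t : R) : C := (RtoC r * cis t)%C.

(** On the circle d/dt z^k = i k z^k, written here in components. *)
Lemma is_derive_polar_monomial (c : C) (k : nat) (t : R) :
  is_derive (fun t => Re (c * zt t ^ k)%C) t (- (INR k * Im (c * zt t ^ k)%C)) /\
  is_derive (fun t => Im (c * zt t ^ k)%C) t (INR k * Re (c * zt t ^ k)%C).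
Proof.
  assert (E : forall s, (c * zt s ^ k)%C = ((c * RtoC (r ^ k)) * cis (INR k * s))%C).
  { intros s. unfold zt. rewrite Cpow_mult_l, <- RtoC_pow, cis_pow. ring. }
  set (d := (c * RtoC (r ^ k))%C) in E. clearbody d.
  split.
  - apply is_derive_ext with (fun s => Re d * cos (INR k * s) - Im d * sin (INR k * s)).
    { intros s. rewrite E, re_mult. reflexivity. }
    rewrite E, im_mult. unfold cis; simpl. clear E. auto_derive; [trivial | ring].
  - apply is_derive_ext with (fun s => Re d * sin (INR k * s) + Im d * cos (INR k * s)).
    { intros s. rewrite E, im_mult. reflexivity. }
    rewrite E, re_mult. unfold cis; simpl. clear E. auto_derive; [trivial | ring].
Qed.

(** The exponents are a function [e] because the map itself uses [k] and its derivative uses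
    [pred k]. *)
Lemma is_derive_polar_sum (c : nat -> C) (e : nat -> nat) (n : nat) (t : R) :
  is_derive (fun t => Re (sum_n (fun k => c k * zt t ^ e k)%C n)) t
    (- Im (sum_n (fun k => RtoC (INR (e k)) * (c k * zt t ^ e k))%C n)) /\
  is_derive (fun t => Im (sum_n (fun k => c k * zt t ^ e k)%C n)) t
    (Re (sum_n (fun k => RtoC (INR (e k)) * (c k * zt t ^ e k))%C n)).
Proof.
  induction n as [|n [IH1 IH2]].
  - destruct (is_derive_polar_monomial (c 0%nat) (e 0%nat) t) as [H1 H2].
    rewrite sum_O, re_scal_l, im_scal_l.
    split; (eapply is_derive_ext; [| eassumption]; intros s; cbv beta; rewrite sum_O; reflexivity).
  - destruct (is_derive_polar_monomial (c (S n)) (e (S n)) t) as [H1 H2].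
    rewrite sum_n_SC, re_plus, im_plus, re_scal_l, im_scal_l.
    split.
    + eapply is_derive_ext.
      2:{ rewrite Ropp_plus_distr.
          exact (is_derive_plus (K := R_AbsRing) (V := R_NormedModule) _ _ t _ _ IH1 H1). }
      intros s. cbv beta. rewrite sum_n_SC, re_plus. reflexivity.
    + eapply is_derive_ext.
      2: exact (is_derive_plus (K := R_AbsRing) (V := R_NormedModule) _ _ t _ _ IH2 H2).
      intros s. cbv beta. rewrite sum_n_SC, im_plus. reflexivity.
Qed.

End PolarDerivatives.

(* The tangent of the curve makes the angle [t - nu + atan (v / u)], up to a
   constant, with a fixed direction; as this angle increases from [0] to
   [2 PI], [q] first decreases and then increases. *)
Lemma support_1d (q u v v1 v2 : R -> R) (r nu t0 : R) :
  0 <= r ->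
  (forall t, is_derive q t (- (r * (u t * sin (t - nu) + v t * cos (t - nu))))) ->
  (forall t, is_derive u t (- v2 t)) ->
  (forall t, is_derive v t (v1 t)) ->
  (forall t, 0 < u t) ->
  (forall t, 0 <= u t * (u t + v1 t) + v t * (v t + v2 t)) ->
  q (t0 + 2 * PI) = q t0 -> u (t0 + 2 * PI) = u t0 -> v (t0 + 2 * PI) = v t0 ->
  t0 - nu + atan (v t0 / u t0) = 0 ->
  forall t, t0 <= t <= t0 + 2 * PI -> q t <= q t0.
Proof.
  intros Hr Dq Du Dv Hu Hc Pq Pu Pv H0 t Ht.
  set (T := fun s => s - nu + atan (v s / u s)).
  (* Since u' = -v2 and v' = v1, the derivative of atan (v / u) is (u v1 + v v2) / (u^2 + v^2);
     adding 1 gives the quantity assumed nonnegative. *)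
  assert (DT : forall s, is_derive T s
    ((u s * (u s + v1 s) + v s * (v s + v2 s)) / (u s ^ 2 + v s ^ 2))).
  { intros s. pose proof (Hu s) as Hus. unfold T.
    evar_last.
    - apply @is_derive_plus.
      + apply @is_derive_minus; [apply is_derive_id | apply @is_derive_const].
      + apply (is_derive_comp atan (fun s => v s / u s)).
        * apply is_derive_atan.
        * apply is_derive_div; [apply Dv | apply Du | lra].
    - unfold minus, opp, scal, one, zero; simpl; unfold mult; simpl.
      repeat match goal with |- context [plus ?x ?y] => change (plus x y) with (x + y) end.
      unfold Rsqr. field. split; [nra | lra]. }
  assert (MT : forall s s', s <= s' -> T s <= T s').
  { intros s s' Hs. eapply le_of_is_derive; [exact Hs | intros x _; apply DT |].
    intros x _. apply Rdiv_le_0_compat; [apply Hc | pose proof (Hu x); nra]. }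
  assert (T0 : T t0 = 0) by exact H0.
  assert (T1 : T (t0 + 2 * PI) = 2 * PI) by (unfold T in *; rewrite Pu, Pv; lra).
  (* u + i v has argument atan (v / u) and modulus u / cos (atan (v / u)), so q' is a nonpositive
     multiple of sin T. *)
  assert (Dq' : forall s, - (r * (u s * sin (s - nu) + v s * cos (s - nu))) =
     - (r * u s / cos (atan (v s / u s))) * sin (T s)).
  { intros s. pose proof (Hu s) as Hus. unfold T. rewrite sin_plus.
    pose proof (tan_atan (v s / u s)) as Et. unfold tan in Et.
    assert (Hcos : 0 < cos (atan (v s / u s))).
    { pose proof (atan_bound (v s / u s)). apply cos_gt_0; lra. }
    assert (E : sin (atan (v s / u s)) = v s / u s * cos (atan (v s / u s))).
    { rewrite <- Et at 2. field. lra. }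
    rewrite E. field. split; lra. }
  assert (Hco : forall s, 0 <= r * u s / cos (atan (v s / u s))).
  { intros s. pose proof (Hu s). pose proof (atan_bound (v s / u s)).
    apply Rdiv_le_0_compat; [nra | apply cos_gt_0; lra]. }
  pose proof PI_RGT_0.
  (* Before T reaches PI the comparison is with the start of the period, after it with the end,
     where q has the same value. *)
  destruct (Rle_dec (T t) PI) as [HT | HT].
  - apply Ropp_le_cancel.
    apply (le_of_is_derive (fun s => - q s)
             (fun s => r * u s / cos (atan (v s / u s)) * sin (T s))); [lra | |].
    + intros x _. evar_last; [apply @is_derive_opp, Dq |]. rewrite Dq'.
      unfold opp; simpl. ring.
    + intros x Hx. apply Rmult_le_pos; [apply Hco|].
      pose proof (MT t0 x ltac:(lra)). pose proof (MT x t ltac:(lra)).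
      apply sin_ge_0; lra.
  - rewrite <- Pq.
    apply (le_of_is_derive q
             (fun s => r * u s / cos (atan (v s / u s)) * - sin (T s))); [lra | |].
    + intros x _. evar_last; [apply Dq |]. rewrite Dq'. ring.
    + intros x Hx. apply Rmult_le_pos; [apply Hco|].
      pose proof (MT t x ltac:(lra)). pose proof (MT x (t0 + 2 * PI) ltac:(lra)).
      pose proof (sin_le_0 (T x)). lra.
Qed.

(** [tau] is the nonnegative root of tau^2 + 2 b tau - d = 0, where [b] is the scalar product of z
    and w and d = r^2 - |z|^2 >= 0. *)
Lemma reach_circle (z w : C) (r : R) : Cmod z <= r -> Cmod w = 1 ->
  exists tau, 0 <= tau /\ Cmod (z + RtoC tau * w) = r.
Proof.
  intros Hz Hw. pose proof (Cmod_ge_0 z) as H0.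
  set (b := Re z * Re w + Im z * Im w).
  set (d := r ^ 2 - Cmod z ^ 2).
  assert (Hd : 0 <= d) by (unfold d; nra).
  assert (Hs : sqrt (b ^ 2 + d) ^ 2 = b ^ 2 + d) by (apply pow2_sqrt; nra).
  exists (- b + sqrt (b ^ 2 + d)). split.
  - assert (Rabs b <= sqrt (b ^ 2 + d)).
    { rewrite <- sqrt_Rsqr_abs. apply sqrt_le_1_alt. unfold Rsqr. nra. }
    pose proof (Rle_abs b). lra.
  - set (s := sqrt (b ^ 2 + d)) in *. clearbody s.
    assert (Hsq : Cmod (z + RtoC (- b + s) * w) ^ 2 = r ^ 2).
    { assert (Hw2 : Re w ^ 2 + Im w ^ 2 = 1) by (rewrite <- Cmod2_alt, Hw; ring).
      rewrite Cmod2_alt, re_plus, im_plus, re_scal_l, im_scal_l.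
      transitivity (Re z ^ 2 + Im z ^ 2 + 2 * (- b + s) * b
                    + (- b + s) ^ 2 * (Re w ^ 2 + Im w ^ 2)); [unfold b; ring|].
      rewrite Hw2, <- Cmod2_alt. unfold d in Hs.
      transitivity (Cmod z ^ 2 - b ^ 2 + s ^ 2); [ring|]. rewrite Hs. ring. }
    pose proof (Cmod_ge_0 (z + RtoC (- b + s) * w)). nra.
Qed.

Definition hpoly (A B : nat -> C) (n : nat) (z : C) : C :=
  (z + sum_n (fun k => A k * z ^ k + Cconj (B k * z ^ k)) n)%C.

(** At k = 0 the factor [INR k] cancels the term, so the value of [pred 0] is harmless. *)
Definition dpoly (D : nat -> C) (n : nat) (z : C) : C :=
  sum_n (fun k => RtoC (INR k) * D k * z ^ pred k)%C n.

(** This is z P'' for the polynomial P with coefficients [D]; the factor z makes the exponent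
    [pred k]. *)
Definition zddpoly (D : nat -> C) (n : nat) (z : C) : C :=
  sum_n (fun k => RtoC (INR (pred k)) * (RtoC (INR k) * D k * z ^ pred k))%C n.

Lemma mult_dpoly (D : nat -> C) (n : nat) (z : C) :
  (z * dpoly D n z)%C = sum_n (fun k => RtoC (INR k) * (D k * z ^ k))%C n.
Proof.
  unfold dpoly. rewrite <- sum_n_scal_C. apply sum_n_ext_C. intros [|k].
  - simpl. ring.
  - simpl pred. rewrite (Cpow_S z k). ring.
Qed.

Lemma dpoly_bound (D : nat -> C) (d : nat -> R) (n : nat) (z : C) (r : R) :
  (forall k, Cmod (D k) <= d k) -> Cmod z <= r ->
  Cmod (dpoly D n z) <= sum_n (fun k => INR k * d k * r ^ pred k) n.
Proof.
  intros HD Hz. apply Cmod_sum_n. intros k _. rewrite Cmod_mult, Cmod_INR_mult.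
  apply Rmult_le_compat; auto using Cmod_ge_0, Cmod_pow_le.
  - apply Rmult_le_pos; [apply pos_INR | apply Cmod_ge_0].
  - apply Rmult_le_compat_l; [apply pos_INR | apply HD].
Qed.

Section ConvexDisk.

Variables (A B : nat -> C) (n : nat) (r kap : R).
Hypothesis r_pos : 0 < r.
Hypothesis kap_lt_1 : kap < 1.
Hypothesis kap_bound :
  sum_n (fun k => INR k * (Cmod (A k) + Cmod (B k)) * r ^ pred k) n <= kap.
Hypothesis convex_bound : forall e z : C, Cmod e = 1 -> Cmod z = r ->
  Cmod (zddpoly (fun k => A k + e * B k)%C n z) <=
  Re (2 * (1 + dpoly (fun k => A k + e * B k) n z)
      + zddpoly (fun k => A k + e * B k)%C n z)%C.

Let f := hpoly A B n.

Lemma hpoly_perturbation (z w : C) : Cmod z <= r -> Cmod w <= r ->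
  Cmod ((f z - z) - (f w - w)) <= kap * Cmod (z - w).
Proof.
  intros Hz Hw. unfold f, hpoly.
  apply Rle_trans with
    (sum_n (fun k => INR k * (Cmod (A k) + Cmod (B k)) * r ^ pred k) n * Cmod (z - w)).
  2:{ apply Rmult_le_compat_r; [apply Cmod_ge_0 | exact kap_bound]. }
  rewrite Rmult_comm, <- sum_n_scal_R.
  replace (_ - _)%C with
    (sum_n (fun k => A k * (z ^ k - w ^ k) + Cconj (B k * (z ^ k - w ^ k)))%C n).
  - apply Cmod_sum_n. intros k _. eapply Rle_trans; [apply Cmod_triangle|].
    rewrite Cmod_conj, !Cmod_mult.
    pose proof (Cmod_pow_sub z w r k Hz Hw).
    pose proof (Cmod_ge_0 (A k)). pose proof (Cmod_ge_0 (B k)). nra.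
  - transitivity (sum_n (fun k => A k * z ^ k + Cconj (B k * z ^ k))%C n
       + (- (1)) * sum_n (fun k => A k * w ^ k + Cconj (B k * w ^ k))%C n)%C; [|cring].
    rewrite <- sum_n_scal_C, <- sum_n_plus_C. apply sum_n_ext_C. intros k.
    unfold Cminus. rewrite !Cmult_conj, Cplus_conj, Copp_conj. ring.
Qed.

Lemma hpoly_injective (z w : C) : Cmod z <= r -> Cmod w <= r -> f z = f w -> z = w.
Proof.
  intros Hz Hw E. pose proof (hpoly_perturbation z w Hz Hw) as H.
  rewrite E in H.
  replace (f w - z - (f w - w))%C with (w - z)%C in H by ring.
  rewrite Cmod_minus_sym in H. pose proof (Cmod_ge_0 (z - w)).
  assert (Cmod (z - w) = 0) by nra.
  apply Ceq_minus. now apply Cmod_eq_0.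
Qed.

(** It keeps 1 + [dpoly D] in the right half-plane, where atan (Im / Re) is a continuous
    argument. *)
Lemma dpoly_small (D : nat -> C) (z : C) :
  (forall k, Cmod (D k) <= Cmod (A k) + Cmod (B k)) -> Cmod z <= r ->
  Cmod (dpoly D n z) <= kap.
Proof.
  intros HD Hz. eapply Rle_trans; [|exact kap_bound].
  exact (dpoly_bound D (fun k => Cmod (A k) + Cmod (B k)) n z r HD Hz).
Qed.

Lemma Cmod_pencil_le (e : C) (k : nat) :
  Cmod e = 1 -> Cmod (A k + e * B k) <= Cmod (A k) + Cmod (B k).
Proof.
  intros He. eapply Rle_trans; [apply Cmod_triangle|]. rewrite Cmod_mult, He. lra.
Qed.

(* For the direction [cis nu] the harmonic map may be replaced by the analytic
   function [F = h + e g] with [e = cis (2 nu)], since both have the same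
   component along [cis nu]. *)
Lemma support_on_circle (t0 nu : R) :
  let e := (cis nu * cis nu)%C in
  let u t := Re (1 + dpoly (fun k => A k + e * B k) n (RtoC r * cis t))%C in
  let v t := Im (1 + dpoly (fun k => A k + e * B k) n (RtoC r * cis t))%C in
  t0 - nu + atan (v t0 / u t0) = 0 ->
  forall z, Cmod z = r ->
    Re (Cconj (cis nu) * f z) <= Re (Cconj (cis nu) * f (RtoC r * cis t0)).
Proof.
  intros e u v H0 z Hz.
  destruct (polar_from z r t0 r_pos Hz) as [t [Ht ->]].
  assert (He : Cmod e = 1) by (unfold e; rewrite Cmod_mult, Cmod_cis; ring).
  set (D := fun k => (A k + e * B k)%C) in *.
  assert (Hcirc : forall s, Cmod (RtoC r * cis s) = r).
  { intros s. rewrite Cmod_RtoC_mult, Cmod_cis, Rabs_pos_eq; lra. }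
  assert (Hpair : forall z, Re (Cconj (cis nu) * f z) =
     Re (Cconj (cis nu) * z) + Re (sum_n (fun k => (Cconj (cis nu) * D k) * z ^ k)%C n)).
  { intros w. unfold f, hpoly. rewrite Cmult_plus_distr_l, re_plus. f_equal.
    rewrite <- sum_n_scal_C, !Re_sum_n. apply sum_n_ext_R. intros k.
    rewrite Cmult_plus_distr_l, re_plus, <- Cmult_assoc.
    replace (D k * w ^ k)%C with (A k * w ^ k + e * (B k * w ^ k))%C by (unfold D; ring).
    rewrite Cmult_plus_distr_l, re_plus. f_equal.
    rewrite <- Cmult_conj, re_conj. f_equal. unfold e.
    transitivity ((Cconj (cis nu) * cis nu) * (cis nu * (B k * w ^ k)))%C; [|ring].
    rewrite cis_conj_mult. ring. }
  (* Along the circle the derivative of Re (conj(w) F(z)) is - Im (conj(w) z F'(z)); this identity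
     puts it in the form that [support_1d] expects. *)
  assert (Hdir : forall s x, Im (Cconj (cis nu) * ((RtoC r * cis s) * x)) =
     r * (Re x * sin (s - nu) + Im x * cos (s - nu))).
  { intros s [a b]. rewrite sin_minus, cos_minus. unfold cis; simpl. ring. }
  apply (support_1d (fun t => Re (Cconj (cis nu) * f (RtoC r * cis t))) u v
           (fun t => Re (zddpoly D n (RtoC r * cis t)))
           (fun t => Im (zddpoly D n (RtoC r * cis t))) r nu t0).
  - lra.
  - intros s.
    apply is_derive_ext with (fun s => plus (Re (Cconj (cis nu) * (RtoC r * cis s) ^ 1))
       (Re (sum_n (fun k => (Cconj (cis nu) * D k) * (RtoC r * cis s) ^ k)%C n))).
    { intros x. rewrite Hpair, Cpow_1_r. reflexivity. }
    evar_last.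
    + apply (is_derive_plus (K := R_AbsRing) (V := R_NormedModule)).
      * exact (proj1 (is_derive_polar_monomial r (Cconj (cis nu)) 1 s)).
      * exact (proj1 (is_derive_polar_sum r (fun k => Cconj (cis nu) * D k)%C (fun k => k) n s)).
    + unfold u, v. rewrite <- Hdir, Cpow_1_r.
      rewrite Cmult_plus_distr_l, mult_dpoly, Cmult_plus_distr_l, <- sum_n_scal_C, im_plus.
      rewrite Cmult_1_r, Ropp_plus_distr. change (INR 1) with 1. rewrite Rmult_1_l.
      apply (f_equal2 Rplus); [reflexivity|]. f_equal. f_equal.
      apply sum_n_ext_C. intros k. ring.
  - intros s. unfold u.
    apply is_derive_ext with (fun s => plus 1 (Re (dpoly D n (RtoC r * cis s)))).
    { intros x. rewrite re_plus. reflexivity. }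
    evar_last.
    + apply (is_derive_plus (K := R_AbsRing) (V := R_NormedModule));
        [apply @is_derive_const|].
      exact (proj1 (is_derive_polar_sum r (fun k => RtoC (INR k) * D k)%C pred n s)).
    + unfold plus, zero; simpl. rewrite Rplus_0_l. reflexivity.
  - intros s. unfold v.
    apply is_derive_ext with (fun s => plus 0 (Im (dpoly D n (RtoC r * cis s)))).
    { intros x. rewrite im_plus. reflexivity. }
    evar_last.
    + apply (is_derive_plus (K := R_AbsRing) (V := R_NormedModule));
        [apply @is_derive_const|].
      exact (proj2 (is_derive_polar_sum r (fun k => RtoC (INR k) * D k)%C pred n s)).
    + unfold plus, zero; simpl. rewrite Rplus_0_l. reflexivity.
  - intros s. unfold u. rewrite re_plus, re_RtoC.
    assert (HD : Cmod (dpoly D n (RtoC r * cis s)) <= kap).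
    { apply dpoly_small; [|rewrite Hcirc; lra]. intros k. now apply Cmod_pencil_le. }
    pose proof (re_ge (dpoly D n (RtoC r * cis s))). lra.
  - intros s. pose proof (convex_bound e (RtoC r * cis s)%C He (Hcirc s)) as HC.
    fold D in HC. unfold u, v.
    set (V := zddpoly D n (RtoC r * cis s)) in *.
    set (G := (1 + dpoly D n (RtoC r * cis s))%C) in *. clearbody V G.
    (* With G = F' and V = z F'', |2 G + V|^2 - |V|^2 = 4 (|G|^2 + Re (conj(G) V)), so |V| <= |2 G +
       V| is the classical condition Re (1 + V / G) >= 0. *)
    assert (H1 : Cmod V <= Cmod (2 * G + V)) by (eapply Rle_trans; [exact HC | apply re_le]).
    assert (H2 : Cmod V ^ 2 <= Cmod (2 * G + V) ^ 2)
      by (apply pow_incr; split; [apply Cmod_ge_0 | exact H1]).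
    rewrite !Cmod2_alt, re_plus, im_plus, re_scal_l, im_scal_l in H2. nra.
  - cbv beta. now rewrite cis_2PI.
  - unfold u. now rewrite cis_2PI.
  - unfold v. now rewrite cis_2PI.
  - exact H0.
  - exact Ht.
Qed.

(** The normal angle has to satisfy t0 - nu + arg F'(z0) = 0, but F depends on nu through e. The
    circle is broken by [W]: along the image curve df/dt = i z0 W, so z0 W is an outward normal that
    can be computed without nu, and nu = t0 + arg W. As Re W > 0, this normal makes an acute angle
    with [cis t0]. *)
Lemma support_normal (t0 : R) :
  exists nu, 0 < Re (Cconj (cis nu) * cis t0) /\
  forall z, Cmod z = r ->
    Re (Cconj (cis nu) * f z) <= Re (Cconj (cis nu) * f (RtoC r * cis t0)).
Proof.
  set (z0 := (RtoC r * cis t0)%C).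
  assert (Hz0 : Cmod z0 <= r).
  { unfold z0. rewrite Cmod_RtoC_mult, Cmod_cis, Rabs_pos_eq; lra. }
  assert (HA : Cmod (dpoly A n z0) + Cmod (dpoly B n z0) <= kap).
  { eapply Rle_trans; [|exact kap_bound].
    pose proof (dpoly_bound A (fun k => Cmod (A k)) n z0 r (fun k => Rle_refl _) Hz0).
    pose proof (dpoly_bound B (fun k => Cmod (B k)) n z0 r (fun k => Rle_refl _) Hz0).
    eapply Rle_trans; [apply Rplus_le_compat; eassumption|]. apply Req_le.
    rewrite <- sum_n_plus_R. apply sum_n_ext_R. intros k. ring. }
  set (W := (1 + dpoly A n z0 - Cconj (cis t0 * cis t0 * dpoly B n z0))%C).
  assert (HW : 0 < Re W).
  { unfold W. rewrite re_minus, re_plus, re_RtoC, re_conj.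
    pose proof (re_ge (dpoly A n z0)).
    pose proof (re_le (cis t0 * cis t0 * dpoly B n z0)%C) as Hb.
    rewrite !Cmod_mult, Cmod_cis in Hb. lra. }
  set (om := atan (Im W / Re W)).
  pose proof (atan_bound (Im W / Re W)) as Hom. fold om in Hom.
  set (nu := t0 + om).
  exists nu.
  set (e := (cis nu * cis nu)%C).
  assert (He : Cmod e = 1) by (unfold e; rewrite Cmod_mult, Cmod_cis; ring).
  split.
  { replace (Re (Cconj (cis nu) * cis t0)) with (cos om); [apply cos_gt_0; lra|].
    replace om with (nu - t0) by (unfold nu; ring). rewrite cos_minus.
    unfold cis; simpl. ring. }
  set (G := (1 + dpoly (fun k => A k + e * B k) n z0)%C).
  assert (EG : G = (1 + dpoly A n z0 + e * dpoly B n z0)%C).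
  { unfold G, dpoly. rewrite <- Cplus_assoc. f_equal.
    rewrite <- sum_n_scal_C, <- sum_n_plus_C. apply sum_n_ext_C. intros k. ring. }
  assert (HG : 0 < Re G).
  { unfold G. rewrite re_plus, re_RtoC.
    assert (HD : Cmod (dpoly (fun k => A k + e * B k)%C n z0) <= kap).
    { apply dpoly_small; [|exact Hz0]. intros k. now apply Cmod_pencil_le. }
    pose proof (re_ge (dpoly (fun k => A k + e * B k)%C n z0)). lra. }
  intros z Hz. apply support_on_circle; [|exact Hz].
  fold e z0 G.
  set (ga := atan (Im G / Re G)).
  pose proof (atan_bound (Im G / Re G)) as Hga. fold ga in Hga.
  assert (Polar : forall X, 0 < Re X ->
     Im X * cos (atan (Im X / Re X)) = Re X * sin (atan (Im X / Re X))).
  { intros X HX. pose proof (atan_bound (Im X / Re X)).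
    assert (0 < cos (atan (Im X / Re X))) by (apply cos_gt_0; lra).
    pose proof (tan_atan (Im X / Re X)) as Et. unfold tan in Et.
    replace (Im X) with (Re X * (Im X / Re X)) at 1 by (field; lra).
    rewrite <- Et at 1. field. lra. }
  pose proof (Polar W HW) as PW. fold om in PW.
  pose proof (Polar G HG) as PG. fold ga in PG.
  (* Both complex numbers have the same imaginary part along [cis nu], which
     vanishes for [W] by the choice of [nu]. *)
  assert (E1 : Im (Cconj (cis nu) * (cis t0 * G)) = Im (Cconj (cis nu) * (cis t0 * W))).
  { rewrite EG. unfold W.
    set (a := dpoly A n z0). set (b := dpoly B n z0).
    replace (Cconj (cis nu) * (cis t0 * (1 + a + e * b)))%C with
      (Cconj (cis nu) * (cis t0 * (1 + a)) + (Cconj (cis nu) * cis nu) * (cis nu * cis t0 * b))%C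
      by (unfold e; ring).
    replace (Cconj (cis nu) * (cis t0 * (1 + a - Cconj (cis t0 * cis t0 * b))))%C with
      (Cconj (cis nu) * (cis t0 * (1 + a))
        - (Cconj (cis t0) * cis t0) * Cconj (cis nu * cis t0 * b))%C
      by (rewrite !Cmult_conj; ring).
    rewrite !cis_conj_mult, im_plus, im_minus, !Cmult_1_l, im_conj. ring. }
  assert (Hrot : forall X, Im (Cconj (cis nu) * (cis t0 * X)) =
    Im X * cos om - Re X * sin om).
  { intros [x y]. replace om with (nu - t0) by (unfold nu; ring).
    rewrite sin_minus, cos_minus. unfold cis; simpl. ring. }
  rewrite !Hrot in E1. rewrite PW in E1.
  assert (E2 : sin (ga - om) = 0).
  { assert (0 < cos ga) by (apply cos_gt_0; lra).
    assert (E3 : Re G * sin (ga - om) = 0).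
    { rewrite sin_minus.
      replace (Re G * (sin ga * cos om - cos ga * sin om)) with
        ((Re G * sin ga) * cos om - Re G * cos ga * sin om) by ring.
      rewrite <- PG.
      replace (Im G * cos ga * cos om - Re G * cos ga * sin om) with
        (cos ga * (Im G * cos om - Re G * sin om)) by ring.
      rewrite E1. ring. }
    apply Rmult_integral in E3. destruct E3; lra. }
  (* Both angles lie in (-PI/2, PI/2), so their difference lies in (-PI, PI), where the sine
     vanishes only at 0. *)
  assert (E4 : ga - om = 0).
  { destruct (Rtotal_order (ga - om) 0) as [Hlt | [Heq | Hgt]]; [|exact Heq|].
    - pose proof (sin_gt_0 (- (ga - om)) ltac:(lra) ltac:(lra)) as Hs.
      rewrite sin_neg in Hs. lra.
    - pose proof (sin_gt_0 (ga - om) ltac:(lra) ltac:(lra)). lra. }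
  unfold nu. lra.
Qed.

(** Pushing a point of the disk by tau in the normal direction until it meets the circle raises the
    component along the normal by at least (1 - kap) tau, because f - id is [kap]-Lipschitz. The
    bound on the circle therefore covers the disk. *)
Lemma support_disk (t0 : R) :
  exists w, Cmod w = 1 /\ 0 < Re (Cconj w * cis t0) /\
  forall z, Cmod z <= r ->
    Re (Cconj w * f z) <= Re (Cconj w * f (RtoC r * cis t0)).
Proof.
  destruct (support_normal t0) as [nu [Hpos Hsup]].
  exists (cis nu). split; [apply Cmod_cis|]. split; [exact Hpos|].
  intros z Hz.
  destruct (reach_circle z (cis nu) r Hz (Cmod_cis nu)) as [tau [Htau Hz']].
  eapply Rle_trans; [|apply Hsup, Hz'].
  set (z' := (z + RtoC tau * cis nu)%C) in *.
  pose proof (hpoly_perturbation z' z ltac:(lra) Hz) as Hp.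
  replace (f z') with (f z + RtoC tau * cis nu + (f z' - z' - (f z - z)))%C
    by (unfold z'; ring).
  replace (z' - z)%C with (RtoC tau * cis nu)%C in Hp by (unfold z'; ring).
  rewrite Cmod_RtoC_mult, Cmod_cis, Rabs_pos_eq in Hp by exact Htau.
  set (p := (f z' - z' - (f z - z))%C) in *.
  replace (Cconj (cis nu) * (f z + RtoC tau * cis nu + p))%C with
    (Cconj (cis nu) * f z + (RtoC tau * (Cconj (cis nu) * cis nu) + Cconj (cis nu) * p))%C
    by ring.
  rewrite cis_conj_mult, !re_plus, re_scal_l.
  pose proof (re_ge (Cconj (cis nu) * p)) as Hge.
  rewrite Cmod_mult, Cmod_conj, Cmod_cis in Hge. simpl (Re 1). nra.
Qed.

End ConvexDisk.

(** * Convexity of harmonic polynomials *)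

Definition disk_proj (r : R) (z : C) : C :=
  if Rle_dec (Cmod z) r then z else (RtoC (r / Cmod z) * z)%C.

Lemma disk_proj_in (r : R) (z : C) : 0 < r -> Cmod (disk_proj r z) <= r.
Proof.
  intros Hr. unfold disk_proj. destruct (Rle_dec (Cmod z) r) as [H | H]; [exact H|].
  rewrite Cmod_RtoC_mult, Rabs_pos_eq; [apply Req_le; field; lra|].
  apply Rdiv_le_0_compat; lra.
Qed.

Lemma re_conj_mult_le (x y : C) : Re (Cconj x * y) <= Cmod x * Cmod y.
Proof. eapply Rle_trans; [apply re_le|]. rewrite Cmod_mult, Cmod_conj. lra. Qed.

(** The obtuse-angle property of the nearest point in a convex set, from which the Lipschitz
    constant 1 follows. *)
Lemma disk_proj_variational (r : R) (z y : C) : 0 < r -> Cmod y <= r ->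
  Re (Cconj (z - disk_proj r z) * (y - disk_proj r z)) <= 0.
Proof.
  intros Hr Hy. unfold disk_proj. destruct (Rle_dec (Cmod z) r) as [H | H].
  - replace (z - z)%C with (RtoC 0) by ring. simpl. lra.
  - assert (Hz : 0 < Cmod z) by lra.
    set (c := r / Cmod z).
    assert (Hc : 0 < c < 1).
    { unfold c. split; [apply Rdiv_lt_0_compat; lra|]. apply Rlt_div_l; lra. }
    assert (E : c * Cmod z = r) by (unfold c; field; lra).
    replace (Re (Cconj (z - RtoC c * z) * (y - RtoC c * z))) with
      ((1 - c) * (Re (Cconj z * y) - c * Cmod z ^ 2)).
    + pose proof (re_conj_mult_le z y). assert (Cmod z * Cmod y <= Cmod z * r) by nra.
      assert (c * Cmod z ^ 2 = r * Cmod z) by (rewrite <- E; ring). nra.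
    + rewrite Cmod2_alt. destruct z as [a b], y as [p q]; simpl. ring.
Qed.

(** Adding the two variational inequalities, each tested at the other projection, gives |p - q|^2 <=
    Re (conj(z - w) (p - q)); Cauchy-Schwarz concludes. *)
Lemma disk_proj_lipschitz (r : R) (z w : C) : 0 < r ->
  Cmod (disk_proj r z - disk_proj r w) <= Cmod (z - w).
Proof.
  intros Hr.
  pose proof (disk_proj_variational r z _ Hr (disk_proj_in r w Hr)) as H1.
  pose proof (disk_proj_variational r w _ Hr (disk_proj_in r z Hr)) as H2.
  set (p := disk_proj r z) in *. set (q := disk_proj r w) in *.
  assert (H3 : Cmod (p - q) ^ 2 <= Re (Cconj (z - w) * (p - q))).
  { rewrite Cmod2_alt. destruct z, w, p, q; simpl in *. lra. }
  pose proof (re_conj_mult_le (z - w) (p - q)).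
  pose proof (Cmod_ge_0 (p - q)). pose proof (Cmod_ge_0 (z - w)).
  destruct (Rle_dec (Cmod (p - q)) (Cmod (z - w))); [assumption | nra].
Qed.

Section FixedPoint.

Variables (T : C -> C) (kap : R).
Hypothesis kap_range : 0 <= kap < 1.
Hypothesis T_contract : forall z w, Cmod (T z - T w) <= kap * Cmod (z - w).

Fixpoint iterate (n : nat) : C := match n with O => RtoC 0 | S m => T (iterate m) end.

Lemma iterate_step (n : nat) :
  Cmod (iterate (S n) - iterate n) <= kap ^ n * Cmod (T (RtoC 0)).
Proof.
  induction n as [|n IH].
  - simpl. replace (T 0 - 0)%C with (T 0) by ring. lra.
  - change (iterate (S (S n))) with (T (iterate (S n))).
    change (iterate (S n)) with (T (iterate n)) at 2.
    eapply Rle_trans; [apply T_contract|]. simpl pow. nra.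
Qed.

(** [p] stands for [Re] or [Im]: completeness is used one real coordinate at a time, for a
    telescoping series dominated by a geometric one. *)
Lemma iterate_component_cv (p : C -> R) :
  (forall x y, p (x - y)%C = p x - p y) -> (forall x, Rabs (p x) <= Cmod x) ->
  ex_finite_lim_seq (fun n => p (iterate n)).
Proof.
  intros Hp Hb.
  assert (Hs : ex_series (fun n => p (iterate (S n)) - p (iterate n))).
  { apply (ex_series_le (K := R_AbsRing) (V := R_CompleteNormedModule)
             _ (fun n => kap ^ n * Cmod (T (RtoC 0)))).
    - intros n. change norm with Rabs. rewrite <- Hp.
      eapply Rle_trans; [apply Hb | apply iterate_step].
    - apply ex_series_scal_r. apply ex_series_geom.
      rewrite Rabs_pos_eq; lra. }
  destruct Hs as [l Hl]. change (is_lim_seq (sum_n (fun n => p (iterate (S n)) - p (iterate n))) (Finite l)) in Hl.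
  exists (l + p (iterate 0)).
  apply (is_lim_seq_incr_1 (fun n => p (iterate n))).
  apply is_lim_seq_ext with
    (fun n => sum_n (fun n => p (iterate (S n)) - p (iterate n)) n + p (iterate 0)).
  - induction n as [|n IH]; [rewrite sum_O; ring|]. rewrite sum_n_SR. lra.
  - eapply is_lim_seq_plus; [exact Hl | apply is_lim_seq_const | reflexivity].
Qed.

Lemma contraction_fixed_point : exists u, T u = u.
Proof.
  destruct (iterate_component_cv Re re_minus re_le_Cmod) as [a Ha].
  destruct (iterate_component_cv Im im_minus im_abs_le) as [b Hb].
  set (u := (a, b) : C). exists u.
  assert (Hd : is_lim_seq (fun n => Rabs (Re (iterate n) - a) + Rabs (Im (iterate n) - b)) 0).
  { assert (K : forall (v : nat -> R) (l : R), is_lim_seq v l ->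
       is_lim_seq (fun n => Rabs (v n - l)) 0).
    { intros v l Hv. rewrite <- (Rabs_R0). replace 0 with (l - l) by ring.
      apply (is_lim_seq_abs (fun n => v n - l) (l - l)).
      eapply is_lim_seq_minus; [exact Hv | apply is_lim_seq_const | reflexivity]. }
    replace 0 with (0 + 0) by ring.
    eapply is_lim_seq_plus; [apply K, Ha | apply K, Hb | reflexivity]. }
  assert (Hmod : forall n, Cmod (iterate n - u) <=
     Rabs (Re (iterate n) - a) + Rabs (Im (iterate n) - b)).
  { intros n. replace (iterate n - u)%C with
      (RtoC (Re (iterate n) - a) + Ci * RtoC (Im (iterate n) - b))%C.
    - eapply Rle_trans; [apply Cmod_triangle|]. rewrite Cmod_mult, Cmod_Ci, !Cmod_R. lra.
    - apply C_ext; unfold u, Re, Im; simpl; ring. }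
  set (d := fun n => Rabs (Re (iterate n) - a) + Rabs (Im (iterate n) - b)) in *.
  assert (H0 : Cmod (T u - u) <= 0).
  { apply (is_lim_seq_le (fun _ => Cmod (T u - u)) (fun n => d n + d (S n)) (Cmod (T u - u)) 0).
    - intros n. eapply Rle_trans; [apply (Cmod_sub_triangle _ (iterate (S n)))|].
      apply Rplus_le_compat; [|apply Hmod].
      simpl. eapply Rle_trans; [apply T_contract|]. rewrite Cmod_minus_sym.
      pose proof (Hmod n). pose proof (Cmod_ge_0 (iterate n - u)). unfold d in *. nra.
    - apply is_lim_seq_const.
    - replace 0 with (0 + 0) by ring.
      apply (is_lim_seq_plus' d (fun n => d (S n)) 0 0); [exact Hd|].
      apply (is_lim_seq_incr_1 d). exact Hd. }
  apply Ceq_minus. apply Cmod_eq_0. pose proof (Cmod_ge_0 (T u - u)). lra.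
Qed.

End FixedPoint.

Definition convex_criterion (A B : nat -> C) (n : nat) (r : R) : Prop :=
  (exists kap, 0 <= kap < 1 /\
     sum_n (fun k => INR k * (Cmod (A k) + Cmod (B k)) * r ^ pred k) n <= kap) /\
  forall e z : C, Cmod e = 1 -> Cmod z = r ->
    Cmod (zddpoly (fun k => A k + e * B k)%C n z) <=
    Re (2 * (1 + dpoly (fun k => A k + e * B k) n z)
        + zddpoly (fun k => A k + e * B k)%C n z)%C.

(* [u |-> u + (f - id)(disk_proj r u)] is a bijection of the plane extending
   [f]; a point outside the disk is mapped strictly beyond a supporting line of
   the image of the disk. *)
Lemma hpoly_convex (A B : nat -> C) (n : nat) (r : R) :
  0 < r -> convex_criterion A B n r ->
  forall z w : C, Cmod z <= r -> Cmod w <= r -> forall t, 0 <= t <= 1 ->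
  exists u, Cmod u <= r /\
    hpoly A B n u = (RtoC (1 - t) * hpoly A B n z + RtoC t * hpoly A B n w)%C.
Proof.
  intros Hr [[kap [Hkap Hsum]] Hconv] z w Hz Hw t Ht.
  set (m := (RtoC (1 - t) * hpoly A B n z + RtoC t * hpoly A B n w)%C).
  set (phi := fun u => (hpoly A B n u - u)%C).
  destruct (contraction_fixed_point (fun u => m - phi (disk_proj r u))%C kap Hkap)
    as [u Hu].
  { intros x y.
    replace (m - phi (disk_proj r x) - (m - phi (disk_proj r y)))%C with
      (phi (disk_proj r y) - phi (disk_proj r x))%C by ring.
    rewrite Cmod_minus_sym.
    eapply Rle_trans;
      [apply (hpoly_perturbation A B n r kap Hsum); now apply disk_proj_in|].
    apply Rmult_le_compat_l; [lra | now apply disk_proj_lipschitz]. }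
  assert (Em : m = (u + phi (disk_proj r u))%C) by (rewrite <- Hu at 1; ring).
  unfold disk_proj in Em. destruct (Rle_dec (Cmod u) r) as [Hin | Hout].
  - exists u. split; [exact Hin|]. rewrite Em. unfold phi. ring.
  - exfalso. assert (Hu0 : 0 < Cmod u) by lra.
    destruct (polar_from u (Cmod u) 0 Hu0 eq_refl) as [t0 [_ Eu]].
    destruct (support_disk A B n r kap Hr (proj2 Hkap) Hsum Hconv t0) as [v [Hv [Hpos Hsup]]].
    assert (Ez : (RtoC (r / Cmod u) * u)%C = (RtoC r * cis t0)%C).
    { rewrite Eu at 2. rewrite Cmult_assoc, <- RtoC_mult. do 2 f_equal. field. lra. }
    rewrite Ez in Em.
    pose proof (Hsup z Hz) as S1. pose proof (Hsup w Hw) as S2.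
    assert (S3 : Re (Cconj v * m) <= Re (Cconj v * hpoly A B n (RtoC r * cis t0))).
    { unfold m.
      replace (Cconj v * (RtoC (1 - t) * hpoly A B n z + RtoC t * hpoly A B n w))%C with
        (RtoC (1 - t) * (Cconj v * hpoly A B n z) + RtoC t * (Cconj v * hpoly A B n w))%C
        by ring.
      rewrite re_plus, !re_scal_l. nra. }
    (* The projection of u is the boundary point r cis(t0), so m is its image shifted by (|u| - r)
       cis(t0); by [Hpos] this shift crosses the supporting line, contradicting [S3]. *)
    assert (E2 : m = (hpoly A B n (RtoC r * cis t0) + RtoC (Cmod u - r) * cis t0)%C).
    { rewrite Em. unfold phi. rewrite Eu at 1. rewrite RtoC_minus. ring. }
    rewrite E2, Cmult_plus_distr_l, re_plus in S3.
    replace (Cconj v * (RtoC (Cmod u - r) * cis t0))%C with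
      (RtoC (Cmod u - r) * (Cconj v * cis t0))%C in S3 by ring.
    rewrite re_scal_l in S3. nra.
Qed.

(** * Eliminating alpha and expanding the derivatives *)

(** Without a quotient, w = 0 is allowed and remainders can be added and rotated directly. *)
Definition cderiv (f : C -> C) (z l : C) : Prop :=
  forall eps, 0 < eps -> exists del, 0 < del /\ forall w, Cmod w < del ->
    Cmod (f (z + w)%C - f z - l * w) <= eps * Cmod w.

Lemma cderiv_plus_mult (f g : C -> C) (e z l m : C) : Cmod e = 1 ->
  cderiv f z l -> cderiv g z m -> cderiv (fun z => f z + e * g z)%C z (l + e * m)%C.
Proof.
  intros He Hf Hg eps Heps.
  destruct (Hf (eps / 2) ltac:(lra)) as [d1 [Hd1 H1]].
  destruct (Hg (eps / 2) ltac:(lra)) as [d2 [Hd2 H2]].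
  exists (Rmin d1 d2). split; [now apply Rmin_pos|]. intros w Hw.
  pose proof (H1 w ltac:(eapply Rlt_le_trans; [exact Hw | apply Rmin_l])) as K1.
  pose proof (H2 w ltac:(eapply Rlt_le_trans; [exact Hw | apply Rmin_r])) as K2.
  replace (_ - _)%C with ((f (z + w)%C - f z - l * w) + e * (g (z + w)%C - g z - m * w))%C by ring.
  eapply Rle_trans; [apply Cmod_triangle|]. rewrite Cmod_mult, He. lra.
Qed.

Lemma cderiv_ray (p : C -> C) (z l : C) (s : R) : cderiv p (RtoC s * z)%C l ->
  derivable_pt_lim (fun s => Re (p (RtoC s * z)%C)) s (Re (z * l)%C).
Proof.
  intros Hp eps Heps. pose proof (Cmod_ge_0 z) as Hz.
  (* The summand 1 covers z = 0, and the factor 2 makes the final inequality strict. *)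
  assert (Hc : 0 < eps / (2 * (Cmod z + 1))) by (apply Rdiv_lt_0_compat; lra).
  destruct (Hp _ Hc) as [d [Hd H]].
  assert (Hd' : 0 < d / (Cmod z + 1)) by (apply Rdiv_lt_0_compat; lra).
  exists (mkposreal _ Hd'). intros x Hx0 Hx. simpl in Hx.
  assert (Hxp : 0 < Rabs x) by now apply Rabs_pos_lt.
  assert (Hxd : Rabs x * (Cmod z + 1) < d) by (apply Rlt_div_r in Hx; lra).
  pose proof (H (RtoC x * z)%C) as Hw. rewrite Cmod_RtoC_mult in Hw.
  specialize (Hw ltac:(nra)).
  replace (RtoC s * z + RtoC x * z)%C with (RtoC (s + x) * z)%C in Hw
    by (rewrite RtoC_plus; ring).
  set (D := (p (RtoC (s + x) * z)%C - p (RtoC s * z)%C - l * (RtoC x * z))%C) in Hw.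
  replace ((Re (p (RtoC (s + x) * z)%C) - Re (p (RtoC s * z)%C)) / x - Re (z * l)%C)
    with (Re D / x).
  - unfold Rdiv at 1. rewrite Rabs_mult, Rabs_inv.
    apply Rle_lt_trans with (eps / (2 * (Cmod z + 1)) * (Rabs x * Cmod z) * / Rabs x).
    + apply Rmult_le_compat_r; [left; now apply Rinv_0_lt_compat|].
      eapply Rle_trans; [apply re_le_Cmod | exact Hw].
    + replace (_ * / Rabs x) with (eps / 2 * (Cmod z / (Cmod z + 1))) by (field; lra).
      assert (Cmod z / (Cmod z + 1) < 1) by (apply Rlt_div_l; lra).
      assert (0 <= Cmod z / (Cmod z + 1)) by (apply Rdiv_le_0_compat; lra). nra.
  - unfold D. replace (l * (RtoC x * z))%C with (RtoC x * (z * l))%C by ring.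
    rewrite !re_minus, re_scal_l. field. exact Hx0.
Qed.

(* At a minimum of [Re p] along the ray towards [z] the radial derivative is
   nonpositive, so the term with [alpha] only helps. *)
Lemma re_lower_bound_on_rays (alpha beta : R) (p dp : C -> C) : 0 <= alpha ->
  (forall z, Cmod z < 1 -> cderiv p z (dp z)) ->
  (forall z, Cmod z < 1 -> beta < Re (p z + RtoC alpha * (z * dp z))%C) ->
  forall z, Cmod z < 1 -> beta < Re (p z).
Proof.
  intros Ha Hd Hp z Hz. set (y := fun s => Re (p (RtoC s * z)%C)).
  pose proof (Cmod_ge_0 z) as Hz0.
  assert (Hin : forall s, 0 <= s <= 1 -> Cmod (RtoC s * z) < 1).
  { intros s Hs. rewrite Cmod_RtoC_mult, Rabs_pos_eq by lra. nra. }
  assert (Dy : forall s, 0 <= s <= 1 ->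
     derivable_pt_lim y s (Re (z * dp (RtoC s * z)%C)%C)).
  { intros s Hs. apply cderiv_ray, Hd, Hin, Hs. }
  destruct (continuity_ab_min y 0 1 ltac:(lra)) as [m [Hmin Hm]].
  { intros c Hc. apply derivable_continuous_pt. eexists. now apply Dy. }
  assert (Hym : beta < y m).
  { pose proof (Hp _ (Hin m Hm)) as Hpm. rewrite re_plus, re_scal_l in Hpm.
    fold (y m) in Hpm.
    replace (RtoC m * z * dp (RtoC m * z)%C)%C with (RtoC m * (z * dp (RtoC m * z)%C))%C
      in Hpm by ring.
    rewrite re_scal_l in Hpm. pose proof (Dy m Hm) as Dm.
    set (l := Re (z * dp (RtoC m * z)%C)%C) in *.
    (* The minimum may sit at an end of [0,1]. At m = 0 the factor m removes the term with alpha;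
       for m > 0 a positive slope would give smaller values just left of m, still inside [0,1]. *)
    destruct (Rle_lt_dec l 0) as [Hl | Hl].
    { assert (0 <= alpha * (m * - l)) by (apply Rmult_le_pos; [|apply Rmult_le_pos]; lra). lra. }
    destruct (Req_dec m 0) as [-> | Hm0]; [lra|].
    exfalso. destruct (Dm (l / 2) ltac:(lra)) as [d Hdel].
    pose proof (cond_pos d) as Hdp.
    set (x := Rmin (d / 2) m).
    assert (Hx : 0 < x <= m /\ x <= d / 2).
    { unfold x. repeat split; [apply Rmin_pos; lra | apply Rmin_r | apply Rmin_l]. }
    specialize (Hdel (- x) ltac:(lra)). rewrite Rabs_Ropp, Rabs_pos_eq in Hdel by lra.
    specialize (Hdel ltac:(lra)). apply Rabs_def2 in Hdel.
    pose proof (Hmin (m + - x) ltac:(lra)) as Hle.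
    assert (Hq : 0 < (y (m + - x) - y m) / - x) by lra.
    assert (E : y (m + - x) - y m = (y (m + - x) - y m) / - x * - x) by (field; lra).
    nra. }
  pose proof (Hmin 1 ltac:(lra)) as H1. unfold y in H1 at 2.
  rewrite Cmult_1_l in H1. lra.
Qed.

(** * Termwise differentiation of power series *)

Definition converges_to (d : nat -> C) (F : C -> C) : Prop :=
  forall z, Cmod z < 1 -> forall eps, 0 < eps -> exists N, forall n, (N <= n)%nat ->
    Cmod (sum_n (fun k => d k * z ^ k)%C n - F z) < eps.

(** Uniform convergence on every smaller closed disk, so that one error bound serves all nodes of an
    average, however many there are. *)
Definition expands (phi : C -> C) (c : nat -> C) : Prop :=
  forall rho eta, 0 < rho < 1 -> 0 < eta -> exists M0, forall M z, (M0 <= M)%nat ->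
    Cmod z <= rho -> Cmod (phi z - sum_n (fun k => c k * z ^ k)%C M) <= eta.

Section PowerSeries.

Variables (d : nat -> C) (F : C -> C).
Hypothesis F_conv : converges_to d F.

Lemma coeff_bounded (rho : R) : 0 < rho < 1 ->
  exists K, 0 <= K /\ forall k, Cmod (d k) * rho ^ k <= K.
Proof.
  intros Hr.
  assert (Hm : Cmod (RtoC rho) < 1) by (rewrite Cmod_R, Rabs_pos_eq; lra).
  destruct (F_conv _ Hm 1 ltac:(lra)) as [N HN].
  set (u := fun k => Cmod (d k) * rho ^ k).
  assert (Hu : forall k, 0 <= u k).
  { intros k. apply Rmult_le_pos; [apply Cmod_ge_0 | apply pow_le; lra]. }
  assert (Hs : forall n k, (k <= n)%nat -> u k <= sum_n u n).
  { induction n as [|n IH]; intros k Hk.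
    - rewrite sum_O. replace k with 0%nat by lia. lra.
    - rewrite sum_n_SR. destruct (Nat.eq_dec k (S n)) as [-> | Hne].
      + pose proof (IH 0%nat ltac:(lia)). pose proof (Hu 0%nat). lra.
      + pose proof (IH k ltac:(lia)). pose proof (Hu (S n)). lra. }
  (* Up to [N] a term is part of the sum; a later one is the difference of two partial sums, each
     within 1 of the limit. *)
  exists (sum_n u N + 2). split.
  { pose proof (Hs N 0%nat ltac:(lia)). pose proof (Hu 0%nat). lra. }
  intros k. change (u k <= sum_n u N + 2). destruct (Nat.le_gt_cases k N) as [Hk | Hk].
  - pose proof (Hs N k Hk). lra.
  - destruct k as [|k]; [lia|].
    pose proof (HN k ltac:(lia)) as H1. pose proof (HN (S k) ltac:(lia)) as H2.
    rewrite sum_n_SC in H2.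
    set (P := sum_n (fun k => d k * RtoC rho ^ k)%C k) in *.
    assert (E : u (S k) = Cmod (d (S k) * RtoC rho ^ S k)%C).
    { unfold u. rewrite Cmod_mult, Cmod_pow, Cmod_R, Rabs_pos_eq by lra. reflexivity. }
    rewrite E.
    replace (d (S k) * RtoC rho ^ S k)%C with
      ((P + d (S k) * RtoC rho ^ S k - F (RtoC rho)) + - (P - F (RtoC rho)))%C by cring.
    eapply Rle_trans; [apply Cmod_triangle|]. rewrite Cmod_opp.
    pose proof (Hs N 0%nat ltac:(lia)). pose proof (Hu 0%nat). lra.
Qed.

(** (1 - t^k) / (1 - t) = 1 + t + ... + t^(k-1) has k terms, each at least t^k. *)
Lemma INR_mult_pow_le (t : R) (k : nat) : 0 <= t < 1 -> INR k * t ^ k <= / (1 - t).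
Proof.
  intros Ht. apply Rle_trans with ((1 - t ^ k) / (1 - t)).
  - apply (proj1 (Rle_div_r (INR k * t ^ k) (1 - t ^ k) (1 - t) ltac:(lra))).
    induction k as [|k IH]; [simpl; lra|].
    rewrite S_INR. simpl pow.
    assert (0 <= t ^ k <= 1).
    { split; [apply pow_le; lra|]. rewrite <- (pow1 k). apply pow_incr. lra. }
    pose proof (pos_INR k).
    assert (t * (INR k * t ^ k * (1 - t)) <= t * (1 - t ^ k))
      by (apply Rmult_le_compat_l; lra).
    assert (0 <= t * t ^ k <= 1) by nra.
    assert (t * t ^ k * (1 - t) <= 1 * (1 - t)) by (apply Rmult_le_compat_r; lra). lra.
  - unfold Rdiv. assert (0 <= t ^ k) by (apply pow_le; lra).
    assert (0 < / (1 - t)) by (apply Rinv_0_lt_compat; lra). nra.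
Qed.

(** The terms are bounded at a larger radius R1. Writing rho / R1 = t^2, one factor t^k absorbs k
    and the other remains as geometric decay. *)
Lemma deriv_coeff_geometric (rho : R) : 0 < rho < 1 ->
  exists K t, 0 <= K /\ 0 < t < 1 /\
    forall k, INR k * Cmod (d k) * rho ^ pred k <= K * t ^ k.
Proof.
  intros Hr. destruct (coeff_bounded ((1 + rho) / 2) ltac:(lra)) as [K [HK Hb]].
  set (R1 := (1 + rho) / 2) in *. assert (HR1 : rho < R1 < 1) by (unfold R1; lra).
  set (t := sqrt (rho / R1)).
  assert (Hx : 0 < rho / R1 < 1).
  { split; [apply Rdiv_lt_0_compat; lra | apply Rlt_div_l; lra]. }
  assert (Ht2 : t * t = rho / R1) by (apply sqrt_sqrt; lra).
  assert (Ht : 0 < t < 1).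
  { split; [apply sqrt_lt_R0; lra|]. rewrite <- sqrt_1. apply sqrt_lt_1_alt. lra. }
  exists (K / rho * / (1 - t)), t. split; [|split; [exact Ht|]].
  { apply Rmult_le_pos; [apply Rdiv_le_0_compat; lra|].
    left. apply Rinv_0_lt_compat. lra. }
  intros k.
  assert (E : INR k * Cmod (d k) * rho ^ pred k =
    (Cmod (d k) * R1 ^ k) * / rho * (INR k * t ^ k) * t ^ k).
  { destruct k as [|k]; [simpl; ring|]. simpl pred.
    assert (Erho : rho ^ S k = R1 ^ S k * (t ^ S k * t ^ S k)).
    { rewrite <- Rpow_mult_distr, Ht2, <- Rpow_mult_distr. f_equal. field. lra. }
    assert (Ep : rho ^ k = / rho * rho ^ S k) by (simpl; field; lra).
    rewrite Ep, Erho. ring. }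
  rewrite E. apply Rmult_le_compat_r; [apply pow_le; lra|].
  apply Rmult_le_compat.
  - apply Rmult_le_pos; [|left; apply Rinv_0_lt_compat; lra].
    apply Rmult_le_pos; [apply Cmod_ge_0 | apply pow_le; lra].
  - apply Rmult_le_pos; [apply pos_INR | apply pow_le; lra].
  - apply Rmult_le_compat_r; [left; apply Rinv_0_lt_compat; lra | apply Hb].
  - apply INR_mult_pow_le. lra.
Qed.

(** Differences of partial sums obey the bound uniformly in their length, so it passes to the
    pointwise limit; convergence of the derivatives is not presupposed. *)
Lemma tail_lipschitz (rho K t : R) (M : nat) (z w : C) :
  0 < rho < 1 -> 0 <= K -> 0 < t < 1 ->
  (forall k, INR k * Cmod (d k) * rho ^ pred k <= K * t ^ k) ->
  Cmod z <= rho -> Cmod w <= rho ->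
  Cmod ((F z - sum_n (fun k => d k * z ^ k)%C M) - (F w - sum_n (fun k => d k * w ^ k)%C M))
    <= K / (1 - t) * t ^ M * Cmod (z - w).
Proof.
  intros Hr HK Ht Hb Hz Hw.
  set (P := fun n z => sum_n (fun k => d k * z ^ k)%C n).
  change (Cmod ((F z - P M z) - (F w - P M w)) <= K / (1 - t) * t ^ M * Cmod (z - w)).
  assert (Hfin : forall j, Cmod ((P (M + j)%nat z - P M z) - (P (M + j)%nat w - P M w)) <=
     K / (1 - t) * (t ^ M - t ^ (M + j)) * Cmod (z - w)).
  { induction j as [|j IH].
    - rewrite Nat.add_0_r.
      replace (P M z - P M z - (P M w - P M w))%C with (RtoC 0) by cring.
      rewrite Cmod_0. lra.
    - rewrite Nat.add_succ_r. set (q := (M + j)%nat) in *.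
      unfold P at 1 3. rewrite !sum_n_SC. fold (P q z). fold (P q w).
      replace (_ - _)%C with
        ((P q z - P M z - (P q w - P M w)) + d (S q) * (z ^ S q - w ^ S q))%C by cring.
      eapply Rle_trans; [apply Cmod_triangle|]. rewrite Cmod_mult.
      pose proof (Cmod_pow_sub z w rho (S q) Hz Hw) as H1.
      pose proof (Hb (S q)) as H2. simpl pred in *. pose proof (Cmod_ge_0 (z - w)) as H3.
      assert (H4 : Cmod (d (S q)) * Cmod (z ^ S q - w ^ S q)%C <= K * t ^ S q * Cmod (z - w)).
      { apply Rle_trans with (INR (S q) * Cmod (d (S q)) * rho ^ q * Cmod (z - w)).
        - pose proof (Cmod_ge_0 (d (S q))). nra.
        - now apply Rmult_le_compat_r. }
      (* Giving up one factor t makes the bounds telescope: t^q = (t^q - t^(q+1)) / (1 - t). *)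
      assert (H5 : K * t ^ S q <= K * t ^ q).
      { apply Rmult_le_compat_l; [exact HK|]. simpl. pose proof (pow_le t q ltac:(lra)). nra. }
      replace (K / (1 - t) * (t ^ M - t ^ S q) * Cmod (z - w)) with
        (K / (1 - t) * (t ^ M - t ^ q) * Cmod (z - w) + K * t ^ q * Cmod (z - w))
        by (simpl; field; lra).
      nra. }
  apply le_epsilon. intros eps Heps.
  destruct (F_conv z ltac:(lra) (eps / 2) ltac:(lra)) as [N1 HN1].
  destruct (F_conv w ltac:(lra) (eps / 2) ltac:(lra)) as [N2 HN2].
  set (j := (N1 + N2)%nat).
  pose proof (HN1 (M + j)%nat ltac:(lia)) as H1. pose proof (HN2 (M + j)%nat ltac:(lia)) as H2.
  fold (P (M + j)%nat z) in H1. fold (P (M + j)%nat w) in H2.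
  pose proof (Hfin j) as H3. set (q := (M + j)%nat) in *.
  replace (F z - P M z - (F w - P M w))%C with
    ((P q z - P M z - (P q w - P M w)) + (- (P q z - F z) + (P q w - F w)))%C by cring.
  eapply Rle_trans; [apply Cmod_triangle|].
  pose proof (Cmod_triangle (- (P q z - F z)) (P q w - F w)) as H4. rewrite Cmod_opp in H4.
  assert (H5 : K / (1 - t) * (t ^ M - t ^ q) * Cmod (z - w) <= K / (1 - t) * t ^ M * Cmod (z - w)).
  { apply Rmult_le_compat_r; [apply Cmod_ge_0|].
    apply Rmult_le_compat_l; [apply Rdiv_le_0_compat; lra|].
    pose proof (pow_le t q ltac:(lra)). lra. }
  lra.
Qed.

Lemma Cmod_pow_taylor (z w : C) (k : nat) : Cmod z <= 1 -> Cmod (z + w) <= 1 ->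
  Cmod ((z + w) ^ k - z ^ k - RtoC (INR k) * z ^ pred k * w)%C <= INR k * INR k * Cmod w ^ 2.
Proof.
  intros Hz Hzw. induction k as [|k IH].
  - simpl. replace (1 - 1 - 0 * 1 * w)%C with (RtoC 0) by ring. rewrite Cmod_0. lra.
  - assert (E : ((z + w) ^ S k - z ^ S k - RtoC (INR (S k)) * z ^ pred (S k) * w)%C =
      ((z + w) * ((z + w) ^ k - z ^ k - RtoC (INR k) * z ^ pred k * w)
       + RtoC (INR k) * (z ^ pred k * (w * w)))%C).
    { rewrite S_INR, RtoC_plus, !Cpow_S. simpl pred.
      destruct k as [|k]; [simpl; ring|]. simpl pred. rewrite !Cpow_S. ring. }
    rewrite E. eapply Rle_trans; [apply Cmod_triangle|].
    rewrite Cmod_INR_mult, !Cmod_mult.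
    set (X := Cmod ((z + w) ^ k - z ^ k - RtoC (INR k) * z ^ pred k * w)%C) in *.
    assert (H1 : Cmod (z + w) * X <= X).
    { pose proof (Cmod_ge_0 ((z + w) ^ k - z ^ k - RtoC (INR k) * z ^ pred k * w)%C).
      fold X in H. nra. }
    assert (H2 : Cmod (z ^ pred k)%C <= 1).
    { rewrite <- (pow1 (pred k)). now apply Cmod_pow_le. }
    pose proof (pos_INR k). pose proof (Cmod_ge_0 (z ^ pred k)%C).
    assert (H5 : 0 <= Cmod w * Cmod w) by (pose proof (Cmod_ge_0 w); nra).
    assert (H6 : INR k * (Cmod (z ^ pred k)%C * (Cmod w * Cmod w)) <= INR k * (Cmod w * Cmod w)).
    { apply Rmult_le_compat_l; [assumption|]. nra. }
    rewrite S_INR. nra.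
Qed.

Lemma cderiv_sum_pow (M : nat) (z : C) : Cmod z < 1 ->
  cderiv (fun z => sum_n (fun k => d k * z ^ k)%C M) z (dpoly d M z).
Proof.
  intros Hz eps Heps.
  set (S2 := sum_n (fun k => INR k * INR k * Cmod (d k)) M).
  assert (HS2 : 0 <= S2).
  { apply sum_n_nonneg. intros k _. pose proof (pos_INR k). pose proof (Cmod_ge_0 (d k)).
    apply Rmult_le_pos; nra. }
  exists (Rmin (1 - Cmod z) (eps / (S2 + 1))). split.
  { apply Rmin_pos; [lra | apply Rdiv_lt_0_compat; lra]. }
  intros w Hw.
  assert (Hw1 : Cmod w < 1 - Cmod z) by (eapply Rlt_le_trans; [exact Hw | apply Rmin_l]).
  assert (Hw2 : Cmod w < eps / (S2 + 1)) by (eapply Rlt_le_trans; [exact Hw | apply Rmin_r]).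
  apply Rlt_div_r in Hw2; [|lra].
  assert (Hzw : Cmod (z + w) <= 1) by (pose proof (Cmod_triangle z w); lra).
  assert (E : (sum_n (fun k => d k * (z + w) ^ k) M - sum_n (fun k => d k * z ^ k) M
      - dpoly d M z * w)%C =
    sum_n (fun k => d k * ((z + w) ^ k - z ^ k - RtoC (INR k) * z ^ pred k * w))%C M).
  { transitivity (sum_n (fun k => d k * (z + w) ^ k) M
      + ((- (1)) * sum_n (fun k => d k * z ^ k) M + (- w) * dpoly d M z))%C; [cring|].
    unfold dpoly. rewrite <- !sum_n_scal_C, <- !sum_n_plus_C. apply sum_n_ext_C.
    intros k. ring. }
  rewrite E. apply Rle_trans with (S2 * Cmod w ^ 2).
  - rewrite Rmult_comm. unfold S2. rewrite <- sum_n_scal_R. apply Cmod_sum_n.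
    intros k _. rewrite Cmod_mult.
    pose proof (Cmod_pow_taylor z w k ltac:(lra) Hzw). pose proof (Cmod_ge_0 (d k)). nra.
  - pose proof (Cmod_ge_0 w). nra.
Qed.

(** The derivative of the tail is at most its Lipschitz constant; a single real increment, small
    enough for both differentiability estimates and for staying in the disk, shows it. *)
Lemma deriv_expansion_error (rho K t : R) (M : nat) (z l : C) :
  0 < rho < 1 -> 0 <= K -> 0 < t < 1 ->
  (forall k, INR k * Cmod (d k) * rho ^ pred k <= K * t ^ k) ->
  Cmod z < rho -> cderiv F z l ->
  Cmod (l - dpoly d M z) <= K / (1 - t) * t ^ M.
Proof.
  intros Hr HK Ht Hb Hz HF. apply le_epsilon. intros eps Heps.
  destruct (HF (eps / 2) ltac:(lra)) as [d1 [Hd1 H1]].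
  destruct (cderiv_sum_pow M z ltac:(lra) (eps / 2) ltac:(lra)) as [d2 [Hd2 H2]].
  set (x := Rmin (Rmin d1 d2) (rho - Cmod z) / 2).
  assert (Hx : 0 < Rmin (Rmin d1 d2) (rho - Cmod z)) by (repeat apply Rmin_pos; lra).
  pose proof (Rmin_l (Rmin d1 d2) (rho - Cmod z)). pose proof (Rmin_r (Rmin d1 d2) (rho - Cmod z)).
  pose proof (Rmin_l d1 d2). pose proof (Rmin_r d1 d2).
  set (w := RtoC x).
  assert (Hw : Cmod w = x) by (unfold w; rewrite Cmod_R, Rabs_pos_eq; unfold x; lra).
  assert (Hx0 : 0 < x) by (unfold x; lra).
  pose proof (H1 w ltac:(unfold x in Hw; lra)) as K1.
  pose proof (H2 w ltac:(unfold x in Hw; lra)) as K2.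
  assert (Hzw : Cmod (z + w) <= rho).
  { pose proof (Cmod_triangle z w). unfold x in Hw. lra. }
  pose proof (tail_lipschitz rho K t M (z + w) z Hr HK Ht Hb Hzw ltac:(lra)) as K3.
  cbv beta in K2.
  set (P1 := sum_n (fun k => d k * (z + w) ^ k)%C M) in *.
  set (P0 := sum_n (fun k => d k * z ^ k)%C M) in *.
  replace (z + w - z)%C with w in K3 by ring.
  assert (K4 : Cmod ((l - dpoly d M z) * w) <= (K / (1 - t) * t ^ M + eps) * Cmod w).
  { replace ((l - dpoly d M z) * w)%C with
      (- (F (z + w)%C - F z - l * w) + ((F (z + w)%C - P1 - (F z - P0))
        + (P1 - P0 - dpoly d M z * w)))%C by cring.
    eapply Rle_trans; [apply Cmod_triangle|]. rewrite Cmod_opp.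
    eapply Rle_trans; [apply Rplus_le_compat_l, Cmod_triangle|]. lra. }
  rewrite Cmod_mult, Hw in K4. eapply Rmult_le_reg_r; [exact Hx0 | exact K4].
Qed.

Lemma dpoly_succ (M : nat) (z : C) :
  dpoly d (S M) z = sum_n (fun k => RtoC (INR (S k)) * d (S k) * z ^ k)%C M.
Proof.
  unfold dpoly. induction M as [|M IH].
  - rewrite sum_n_SC, !sum_O. simpl. cring.
  - rewrite sum_n_SC, IH, sum_n_SC. reflexivity.
Qed.

Lemma derivative_expands (F' : C -> C) :
  (forall z, Cmod z < 1 -> cderiv F z (F' z)) ->
  expands F' (fun k => RtoC (INR (S k)) * d (S k))%C.
Proof.
  intros HF rho eta Hr He.
  (* The larger radius leaves room for increments at points with |z| = rho. *)
  destruct (deriv_coeff_geometric ((1 + rho) / 2) ltac:(lra)) as [K [t [HK [Ht Hb]]]].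
  assert (HL : is_lim_seq (fun M => K / (1 - t) * t ^ M) 0).
  { replace (Finite 0) with (Rbar_mult (K / (1 - t)) 0) by (simpl; f_equal; ring).
    apply is_lim_seq_scal_l. apply is_lim_seq_geom. rewrite Rabs_pos_eq; lra. }
  apply is_lim_seq_spec in HL. destruct (HL (mkposreal eta He)) as [N HN].
  exists N. intros M z HM Hz.
  rewrite <- dpoly_succ.
  eapply Rle_trans.
  - apply (deriv_expansion_error ((1 + rho) / 2) K t (S M) z (F' z)); auto; try lra.
    apply HF. lra.
  - specialize (HN (S M) ltac:(lia)). simpl pos in HN. rewrite Rminus_0_r in HN.
    apply Rabs_def2 in HN. lra.
Qed.

End PowerSeries.

(** * Coefficients of functions with positive real part *)

(** The mean over the (n+1)-th roots of unity, a finite substitute for the mean over the circle; it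
    is exact for trigonometric polynomials of degree at most n. *)
Definition avg (n : nat) (f : C -> C) : C :=
  (RtoC (/ INR (S n)) * sum_n (fun j => f (cis (INR j * (2 * PI / INR (S n))))) n)%C.

Lemma avg_ext (n : nat) (f g : C -> C) :
  (forall x, Cmod x = 1 -> f x = g x) -> avg n f = avg n g.
Proof.
  intros H. unfold avg. f_equal. apply sum_n_ext_C. intros j. apply H, Cmod_cis.
Qed.

Lemma avg_plus (n : nat) (f g : C -> C) : avg n (fun x => f x + g x)%C = (avg n f + avg n g)%C.
Proof. unfold avg. rewrite sum_n_plus_C. ring. Qed.

Lemma avg_mult (n : nat) (c : C) (f : C -> C) : avg n (fun x => c * f x)%C = (c * avg n f)%C.
Proof. unfold avg. rewrite sum_n_scal_C. ring. Qed.

Lemma avg_conj (n : nat) (f : C -> C) : avg n (fun x => Cconj (f x)) = Cconj (avg n f).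
Proof.
  unfold avg. rewrite Cmult_conj, Cconj_sum_n. f_equal. unfold Cconj, RtoC; simpl. f_equal. ring.
Qed.

Lemma INR_S_pos (n : nat) : 0 < INR (S n).
Proof. apply lt_0_INR. lia. Qed.

Lemma sum_n_const_1 (n : nat) : sum_n (fun _ => 1) n = INR (S n).
Proof. rewrite sum_n_const. apply Rmult_1_r. Qed.

Lemma Re_avg_nonneg (n : nat) (f : C -> C) :
  (forall x, Cmod x = 1 -> 0 <= Re (f x)) -> 0 <= Re (avg n f).
Proof.
  intros H. unfold avg. rewrite re_scal_l, Re_sum_n. pose proof (INR_S_pos n).
  apply Rmult_le_pos; [left; now apply Rinv_0_lt_compat|].
  apply sum_n_nonneg. intros k _. apply H, Cmod_cis.
Qed.

Lemma Cmod_avg_le (n : nat) (f : C -> C) (eta : R) :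
  (forall x, Cmod x = 1 -> Cmod (f x) <= eta) -> Cmod (avg n f) <= eta.
Proof.
  intros H. unfold avg. pose proof (INR_S_pos n) as Hn.
  rewrite Cmod_RtoC_mult, Rabs_pos_eq by (left; now apply Rinv_0_lt_compat).
  apply Rle_trans with (/ INR (S n) * (eta * INR (S n))); [|right; field; lra].
  apply Rmult_le_compat_l; [left; now apply Rinv_0_lt_compat|].
  rewrite <- (sum_n_const_1 n), <- sum_n_scal_R. apply Cmod_sum_n.
  intros k _. rewrite Rmult_1_r. apply H, Cmod_cis.
Qed.

Lemma avg_1 (n : nat) : avg n (fun _ => 1%C) = 1%C.
Proof.
  unfold avg. pose proof (INR_S_pos n) as Hn.
  assert (E : sum_n (fun _ => RtoC 1) n = RtoC (INR (S n))).
  { clear. induction n as [|n IH]; [now rewrite sum_O|].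
    rewrite sum_n_SC, IH, (S_INR (S n)), RtoC_plus. reflexivity. }
  rewrite E, <- RtoC_mult. f_equal. field. lra.
Qed.

Lemma cis_2PI_INR (m : nat) : cis (INR m * (2 * PI)) = 1%C.
Proof.
  induction m as [|m IH]; [rewrite Rmult_0_l; apply cis_0|].
  rewrite S_INR, Rmult_plus_distr_r, Rmult_1_l, cis_2PI. exact IH.
Qed.

Lemma cis_neq_1 (t : R) : 0 < t < 2 * PI -> cis t <> 1%C.
Proof.
  intros Ht E. assert (Hc : cos t = 1) by (apply (f_equal Re) in E; exact E).
  replace t with (2 * (t / 2)) in Hc by field. rewrite cos_2a_sin in Hc.
  pose proof (sin_gt_0 (t / 2) ltac:(lra) ltac:(lra)). nra.
Qed.

Lemma geometric_sum (w : C) (n : nat) : ((1 - w) * sum_n (fun j => w ^ j)%C n)%C = (1 - w ^ S n)%C.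
Proof.
  induction n as [|n IH].
  - rewrite sum_O. simpl. ring.
  - rewrite sum_n_SC, Cmult_plus_distr_l, IH, (Cpow_S w (S n)). ring.
Qed.

Lemma avg_pow (n d : nat) : (0 < d <= n)%nat -> avg n (fun x => x ^ d)%C = 0%C.
Proof.
  intros Hd. pose proof (INR_S_pos n) as Hn.
  set (w := cis (INR d * (2 * PI / INR (S n)))).
  assert (Hw : (1 - w)%C <> 0%C).
  { apply Cminus_eq_contra, not_eq_sym, cis_neq_1.
    assert (0 < INR d) by (apply lt_0_INR; lia).
    assert (INR d < INR (S n)) by (apply lt_INR; lia).
    pose proof PI_RGT_0. split.
    - apply Rmult_lt_0_compat; [lra | apply Rdiv_lt_0_compat; lra].
    - replace (INR d * (2 * PI / INR (S n))) with (2 * PI * (INR d / INR (S n))) by (field; lra).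
      assert (INR d / INR (S n) < 1) by (apply Rlt_div_l; lra). nra. }
  assert (E : sum_n (fun j => (cis (INR j * (2 * PI / INR (S n))) ^ d)%C) n = RtoC 0).
  { rewrite (sum_n_ext_C _ (fun j => w ^ j)%C).
    2:{ intros j. unfold w. rewrite !cis_pow. f_equal. ring. }
    pose proof (geometric_sum w n) as G.
    assert (Ew : (w ^ S n)%C = 1%C).
    { unfold w. rewrite cis_pow.
      replace (INR (S n) * (INR d * (2 * PI / INR (S n)))) with (INR d * (2 * PI)) by (field; lra).
      apply cis_2PI_INR. }
    rewrite Ew in G.
    destruct (Ceq_dec (sum_n (fun j => w ^ j)%C n) 0) as [H0 | H0]; [exact H0|].
    exfalso. apply (Cmult_neq_0 _ _ Hw H0). rewrite G. ring. }
  unfold avg. rewrite E. ring.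
Qed.

Lemma unit_conj_mult_pow (x : C) (m : nat) : Cmod x = 1 -> (Cconj x ^ m * x ^ m)%C = 1%C.
Proof.
  intros Hx. rewrite <- Cpow_mult_l.
  assert (E : (Cconj x * x)%C = 1%C).
  { rewrite Cmult_comm, <- Cmod2_conj, Hx, RtoC_pow. ring. }
  rewrite E. apply Cpow_1_l.
Qed.

Lemma avg_conj_pow_pow (n m k : nat) : (m <= n)%nat -> (k <= n)%nat ->
  avg n (fun x => Cconj x ^ m * x ^ k)%C = if Nat.eq_dec k m then 1%C else 0%C.
Proof.
  intros Hm Hk. destruct (Nat.eq_dec k m) as [-> | Hne].
  - rewrite <- (avg_1 n). apply avg_ext. intros x Hx. now apply unit_conj_mult_pow.
  - destruct (Nat.lt_total k m) as [Hlt | [Heq | Hlt]]; [|lia|].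
    + rewrite (avg_ext n _ (fun x => Cconj (x ^ (m - k)%nat)%C)).
      2:{ intros x Hx. replace m with ((m - k) + k)%nat at 1 by lia.
          rewrite Cpow_add_r, <- Cmult_assoc, unit_conj_mult_pow, Cpow_conj by exact Hx. ring. }
      rewrite (avg_conj n (fun x => x ^ (m - k)%nat)%C), avg_pow by lia.
      apply C_ext; simpl; ring.
    + rewrite (avg_ext n _ (fun x => x ^ (k - m)%nat)%C).
      2:{ intros x Hx. replace k with (m + (k - m))%nat at 1 by lia.
          rewrite Cpow_add_r, Cmult_assoc, unit_conj_mult_pow by exact Hx. ring. }
      apply avg_pow. lia.
Qed.

Lemma avg_conj_pow_poly (n m M : nat) (c : nat -> C) (rho : R) :
  (m <= n)%nat -> (M <= n)%nat -> (m <= M)%nat ->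
  avg n (fun x => Cconj x ^ m * sum_n (fun k => c k * (RtoC rho * x) ^ k) M)%C
    = (c m * RtoC (rho ^ m))%C.
Proof.
  intros Hm HM HmM.
  assert (H : forall L, (L <= n)%nat ->
    avg n (fun x => Cconj x ^ m * sum_n (fun k => c k * (RtoC rho * x) ^ k) L)%C =
    if le_dec m L then (c m * RtoC (rho ^ m))%C else 0%C).
  { assert (T : forall k, (k <= n)%nat ->
      avg n (fun x => Cconj x ^ m * (c k * (RtoC rho * x) ^ k))%C =
      if Nat.eq_dec k m then (c m * RtoC (rho ^ m))%C else 0%C).
    { intros k Hk.
      rewrite (avg_ext n _ (fun x => (c k * RtoC (rho ^ k)) * (Cconj x ^ m * x ^ k))%C).
      2:{ intros x _. rewrite Cpow_mult_l, RtoC_pow. ring. }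
      rewrite avg_mult, avg_conj_pow_pow by assumption.
      destruct (Nat.eq_dec k m) as [-> | _]; ring. }
    induction L as [|L IH]; intros HL.
    - rewrite (avg_ext n _ (fun x => Cconj x ^ m * (c 0%nat * (RtoC rho * x) ^ 0))%C)
        by (intros x _; rewrite sum_O; reflexivity).
      rewrite T by assumption.
      destruct (Nat.eq_dec 0 m), (le_dec m 0); try lia; reflexivity.
    - rewrite (avg_ext n _ (fun x =>
        Cconj x ^ m * sum_n (fun k => c k * (RtoC rho * x) ^ k) L
        + Cconj x ^ m * (c (S L) * (RtoC rho * x) ^ S L))%C).
      2:{ intros x _. rewrite sum_n_SC. cring. }
      rewrite avg_plus, T, IH by lia.
      destruct (Nat.eq_dec (S L) m), (le_dec m L), (le_dec m (S L)); try lia; ring. }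
  rewrite H by exact HM. destruct (le_dec m M); [reflexivity | lia].
Qed.

(** The condition m + M <= n excludes aliasing, as x^(n+1) = 1 at every node. *)
Lemma avg_pow_poly (n m M : nat) (c : nat -> C) (rho : R) :
  (0 < m)%nat -> (m + M <= n)%nat ->
  avg n (fun x => x ^ m * sum_n (fun k => c k * (RtoC rho * x) ^ k) M)%C = 0%C.
Proof.
  intros Hm HM.
  assert (T : forall k, (k <= M)%nat -> avg n (fun x => x ^ m * (c k * (RtoC rho * x) ^ k))%C = 0%C).
  { intros k Hk.
    rewrite (avg_ext n _ (fun x => (c k * RtoC (rho ^ k)) * x ^ (m + k)%nat)%C).
    2:{ intros x _. rewrite Cpow_mult_l, Cpow_add_r, RtoC_pow. ring. }
    rewrite avg_mult, avg_pow by lia. ring. }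
  induction M as [|M IH].
  - rewrite (avg_ext n _ (fun x => x ^ m * (c 0%nat * (RtoC rho * x) ^ 0))%C)
      by (intros x _; rewrite sum_O; reflexivity).
    apply T. lia.
  - rewrite (avg_ext n _ (fun x =>
        x ^ m * sum_n (fun k => c k * (RtoC rho * x) ^ k) M
        + x ^ m * (c (S M) * (RtoC rho * x) ^ S M))%C).
    2:{ intros x _. rewrite sum_n_SC. cring. }
    rewrite avg_plus, T, IH; [ring | lia | intros; apply T; lia | lia].
Qed.

(** Negative frequencies recover the coefficients and positive ones give almost 0, because phi is
    analytic. One threshold serves all m <= K, so that several moments can be combined in a single
    average. *)
Lemma expands_moments (phi : C -> C) (c : nat -> C) (rho eta : R) (K : nat) :
  expands phi c -> 0 < rho < 1 -> 0 < eta ->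
  exists n0, forall n, (n0 <= n)%nat -> forall m, (m <= K)%nat ->
    Cmod (avg n (fun x => Cconj x ^ m * phi (RtoC rho * x)%C)%C - c m * RtoC (rho ^ m)) <= eta /\
    ((0 < m)%nat -> Cmod (avg n (fun x => x ^ m * phi (RtoC rho * x)%C)%C) <= eta).
Proof.
  intros Hphi Hr He. destruct (Hphi rho eta Hr He) as [M0 HM].
  set (M := (M0 + K)%nat). exists (K + M)%nat. intros n Hn m Hm.
  set (P := fun x => sum_n (fun k => c k * (RtoC rho * x) ^ k)%C M).
  assert (Herr : forall x, Cmod x = 1 -> Cmod (phi (RtoC rho * x)%C - P x) <= eta).
  { intros x Hx. apply HM; [lia|]. rewrite Cmod_RtoC_mult, Hx, Rabs_pos_eq; lra. }
  split.
  - rewrite <- (avg_conj_pow_poly n m M c rho) by lia. fold P.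
    rewrite (avg_ext n (fun x => Cconj x ^ m * phi (RtoC rho * x)%C)%C
      (fun x => Cconj x ^ m * P x + Cconj x ^ m * (phi (RtoC rho * x)%C - P x))%C)
      by (intros x _; ring).
    rewrite avg_plus.
    change (Cmod (avg n (fun x => Cconj x ^ m * P x)%C
      + avg n (fun x => Cconj x ^ m * (phi (RtoC rho * x)%C - P x))%C
      - avg n (fun x => Cconj x ^ m * P x)%C) <= eta).
    replace (_ - _)%C with (avg n (fun x => Cconj x ^ m * (phi (RtoC rho * x)%C - P x))%C) by ring.
    apply Cmod_avg_le. intros x Hx. rewrite Cmod_mult, Cmod_pow, Cmod_conj, Hx, pow1.
    rewrite Rmult_1_l. now apply Herr.
  - intros Hm0.
    rewrite (avg_ext n (fun x => x ^ m * phi (RtoC rho * x)%C)%C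
      (fun x => x ^ m * P x + x ^ m * (phi (RtoC rho * x)%C - P x))%C)
      by (intros x _; ring).
    rewrite avg_plus. unfold P at 1. rewrite avg_pow_poly by lia. rewrite Cplus_0_l.
    apply Cmod_avg_le. intros x Hx. rewrite Cmod_mult, Cmod_pow, Hx, pow1.
    rewrite Rmult_1_l. now apply Herr.
Qed.

(** The passage rho -> 1: averages are available only on circles inside the disk. *)
Lemma nonneg_at_1 (a b c : R) (m k : nat) :
  (forall rho, 0 < rho < 1 -> 0 <= a + b * rho ^ m + c * rho ^ k) -> 0 <= a + b + c.
Proof.
  intros H. set (f := fun x => a + b * x ^ m + c * x ^ k).
  assert (Hc : continuity_pt f 1).
  { apply derivable_continuous_pt. unfold f.
    eexists. apply is_derive_Reals. auto_derive; [trivial | reflexivity]. }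
  assert (E : f 1 = a + b + c) by (unfold f; rewrite !pow1; ring).
  rewrite <- E. destruct (Rle_lt_dec 0 (f 1)) as [Hp | Hn]; [exact Hp|]. exfalso.
  destruct (Hc (- f 1) ltac:(lra)) as [d [Hd Hlim]].
  set (x := Rmax (1 / 2) (1 - d / 2)).
  assert (Hx : 1 / 2 <= x /\ 1 - d / 2 <= x /\ x < 1).
  { unfold x. repeat split; [apply Rmax_l | apply Rmax_r | apply Rmax_lub_lt; lra]. }
  specialize (Hlim x). simpl in Hlim. unfold R_dist in Hlim.
  assert (Hfx : Rabs (f x - f 1) < - f 1).
  { apply Hlim. split; [split; [exact I | lra]|]. rewrite Rabs_left; lra. }
  apply Rabs_def2 in Hfx. pose proof (H x ltac:(lra)). unfold f in *. lra.
Qed.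

(* The real part of [phi] is a positive harmonic function; its average on a
   circle against a nonnegative trigonometric polynomial is nonnegative. *)
Lemma trig_nonneg (phi : C -> C) (c : nat -> C) (g t0 : R) (t1 t2 : C) (m k : nat) :
  expands phi c -> c 0%nat = RtoC g -> (forall z, Cmod z < 1 -> 0 <= Re (phi z)) ->
  (0 < m)%nat -> (0 < k)%nat ->
  (forall x, Cmod x = 1 -> 0 <= t0 + Re (t1 * x ^ m) + Re (t2 * x ^ k)) ->
  0 <= t0 * g + Re (t1 * c m) / 2 + Re (t2 * c k) / 2.
Proof.
  intros Hphi Hc0 Hpos Hm Hk HT.
  apply (nonneg_at_1 (t0 * g) _ _ m k). intros rho Hr.
  apply le_epsilon. intros eps Heps.
  set (L := Rabs t0 + Cmod t1 + Cmod t2).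
  assert (HL : 0 <= L).
  { unfold L. pose proof (Rabs_pos t0). pose proof (Cmod_ge_0 t1). pose proof (Cmod_ge_0 t2). lra. }
  set (eta := eps / (L + 1)).
  assert (Heta : 0 < eta) by (apply Rdiv_lt_0_compat; lra).
  assert (HLeta : L * eta <= eps).
  { unfold eta. replace (L * (eps / (L + 1))) with (eps * (L / (L + 1))) by (field; lra).
    assert (L / (L + 1) < 1) by (apply Rlt_div_l; lra). nra. }
  destruct (expands_moments phi c rho eta (m + k) Hphi Hr Heta) as [n Hn].
  specialize (Hn n (le_n n)).
  set (p := fun x => phi (RtoC rho * x)%C) in *.
  set (q0 := avg n (fun x => Cconj x ^ 0 * p x)%C).
  set (q1 := avg n (fun x => Cconj x ^ m * p x)%C).
  set (q1' := avg n (fun x => x ^ m * p x)%C).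
  set (q2 := avg n (fun x => Cconj x ^ k * p x)%C).
  set (q2' := avg n (fun x => x ^ k * p x)%C).
  assert (Havg : 0 <= Re (RtoC t0 * q0 + (RtoC (/ 2) * (t1 * q1) + RtoC (/ 2) * (Cconj t1 * q1'))
      + (RtoC (/ 2) * (t2 * q2) + RtoC (/ 2) * (Cconj t2 * q2')))%C).
  { unfold q0, q1, q1', q2, q2'. rewrite <- !avg_mult, <- !avg_plus.
    apply Re_avg_nonneg. intros x Hx.
    (* Conjugating x makes t1 meet c_m: in Re (t1 conj(x)^m) = (t1 conj(x)^m + conj(t1) x^m) / 2 the
       first half yields t1 c_m and the second averages to almost 0. This is the origin of the
       factors 1/2. *)
    specialize (HT (Cconj x) ltac:(now rewrite Cmod_conj)).
    specialize (Hpos (RtoC rho * x)%C ltac:(rewrite Cmod_RtoC_mult, Hx, Rabs_pos_eq; lra)).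
    change (phi (RtoC rho * x)%C) with (p x) in Hpos.
    replace (_ + _)%C with (RtoC (t0 + Re (t1 * Cconj x ^ m) + Re (t2 * Cconj x ^ k)) * p x)%C.
    - rewrite re_scal_l. now apply Rmult_le_pos.
    - rewrite !RtoC_plus, !re_alt, !Cmult_conj, <- !Cpow_conj, !Cconj_conj, !RtoC_inv by lra.
      replace (Cconj (x ^ 0)%C) with (RtoC 1) by (apply C_ext; simpl; ring). field. }
  assert (B0 : Cmod (q0 - RtoC g) <= eta).
  { pose proof (proj1 (Hn 0%nat ltac:(lia))) as H. fold q0 in H.
    rewrite Hc0 in H. simpl (rho ^ 0) in H. rewrite Cmult_1_r in H. exact H. }
  destruct (Hn m ltac:(lia)) as [B1 B1']. specialize (B1' Hm). fold q1 in B1. fold q1' in B1'.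
  destruct (Hn k ltac:(lia)) as [B2 B2']. specialize (B2' Hk). fold q2 in B2. fold q2' in B2'.
  rewrite !re_plus, !re_scal_l in Havg.
  assert (A0 : t0 * Re q0 <= t0 * g + Rabs t0 * eta).
  { pose proof (re_le (RtoC t0 * (q0 - RtoC g))) as H.
    rewrite Cmod_RtoC_mult, re_scal_l, re_minus, re_RtoC in H.
    pose proof (Rabs_pos t0). nra. }
  assert (A1 : forall t q (c : C) s, Cmod (q - c * RtoC s) <= eta ->
     Re (t * q) <= Re (t * c) * s + Cmod t * eta).
  { intros t q c' s Hq. pose proof (re_le (t * (q - c' * RtoC s))%C) as H.
    rewrite Cmod_mult in H. pose proof (Cmod_ge_0 t).
    replace (t * (q - c' * RtoC s))%C with (t * q - (t * c') * RtoC s)%C in H by ring.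
    rewrite re_minus, re_scal_r in H. nra. }
  assert (A2 : forall t q, Cmod q <= eta -> Re (Cconj t * q) <= Cmod t * eta).
  { intros t q Hq. eapply Rle_trans; [apply re_conj_mult_le|].
    apply Rmult_le_compat_l; [apply Cmod_ge_0 | exact Hq]. }
  pose proof (A1 t1 q1 _ _ B1). pose proof (A1 t2 q2 _ _ B2).
  pose proof (A2 t1 q1' B1'). pose proof (A2 t2 q2' B2').
  unfold L in HLeta. lra.
Qed.

(** The polynomial used is 1 - Re (e x^m), with e chosen so that e c_m = |c_m|. *)
Lemma caratheodory_bound (phi : C -> C) (c : nat -> C) (g : R) (m : nat) :
  expands phi c -> c 0%nat = RtoC g -> (forall z, Cmod z < 1 -> 0 <= Re (phi z)) ->
  (0 < m)%nat -> Cmod (c m) <= 2 * g.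
Proof.
  intros Hphi Hc0 Hpos Hm. destruct (unit_direction (c m)) as [e [He E]].
  pose proof (trig_nonneg phi c g 1 (- e) 0 m m Hphi Hc0 Hpos Hm Hm) as H.
  replace (- e * c m)%C with (- (e * c m))%C in H by ring.
  rewrite E, Cmult_0_l, re_opp, !re_RtoC in H.
  cut (0 <= 1 * g + - Cmod (c m) / 2 + 0 / 2); [lra|]. apply H.
  intros x Hx. pose proof (re_ge (- e * x ^ m)%C) as Hge.
  rewrite Cmod_mult, Cmod_opp, He, Cmod_pow, Hx, pow1 in Hge.
  rewrite Cmult_0_l, re_RtoC. lra.
Qed.

(** |b_m| rho^m is at most the mean of |psi| on the circle of radius rho, hence at most the mean of
    Re phi, which is g. *)
Lemma subordinate_bound (phi psi : C -> C) (c b : nat -> C) (g : R) (m : nat) :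
  expands phi c -> expands psi b -> c 0%nat = RtoC g ->
  (forall z, Cmod z < 1 -> Cmod (psi z) <= Re (phi z)) ->
  Cmod (b m) <= g.
Proof.
  intros Hphi Hpsi Hc0 Hdom.
  cut (0 <= g + - Cmod (b m) + 0); [lra|].
  apply (nonneg_at_1 _ _ _ m m). intros rho Hr. apply le_epsilon. intros eps Heps.
  destruct (expands_moments phi c rho (eps / 2) 0 Hphi Hr ltac:(lra)) as [n1 H1].
  destruct (expands_moments psi b rho (eps / 2) m Hpsi Hr ltac:(lra)) as [n2 H2].
  set (n := (n1 + n2)%nat).
  destruct (H1 n ltac:(lia) 0%nat ltac:(lia)) as [B0 _].
  destruct (H2 n ltac:(lia) m ltac:(lia)) as [Bm _].
  rewrite Hc0 in B0. simpl (rho ^ 0) in B0. rewrite Cmult_1_r in B0.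
  destruct (unit_direction (b m)) as [e [He E]].
  set (q0 := avg n (fun x => Cconj x ^ 0 * phi (RtoC rho * x)%C)%C) in *.
  set (qm := avg n (fun x => Cconj x ^ m * psi (RtoC rho * x)%C)%C) in *.
  assert (Havg : 0 <= Re (q0 + - e * qm)).
  { unfold q0, qm. rewrite <- avg_mult, <- avg_plus. apply Re_avg_nonneg. intros x Hx.
    specialize (Hdom (RtoC rho * x)%C ltac:(rewrite Cmod_RtoC_mult, Hx, Rabs_pos_eq; lra)).
    simpl (Cconj x ^ 0)%C. rewrite re_plus, Cmult_1_l.
    pose proof (re_ge (- e * (Cconj x ^ m * psi (RtoC rho * x)%C))%C) as Hge.
    rewrite !Cmod_mult, Cmod_opp, He, Cmod_pow, Cmod_conj, Hx, pow1 in Hge. lra. }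
  rewrite re_plus in Havg.
  pose proof (re_le (q0 - RtoC g)%C) as K0. rewrite re_minus, re_RtoC in K0.
  pose proof (re_le (- e * (qm - b m * RtoC (rho ^ m)))%C) as K1.
  rewrite Cmod_mult, Cmod_opp, He in K1.
  replace (- e * (qm - b m * RtoC (rho ^ m)))%C with
    (- e * qm + (e * b m) * RtoC (rho ^ m))%C in K1 by ring.
  rewrite E, re_plus, re_scal_r, re_RtoC in K1. lra.
Qed.

Lemma expands_pencil (phi psi : C -> C) (c b : nat -> C) (e : C) : Cmod e = 1 ->
  expands phi c -> expands psi b ->
  expands (fun z => phi z + e * psi z)%C (fun k => c k + e * b k)%C.
Proof.
  intros He Hphi Hpsi rho eta Hr Heta.
  destruct (Hphi rho (eta / 2) Hr ltac:(lra)) as [M1 H1].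
  destruct (Hpsi rho (eta / 2) Hr ltac:(lra)) as [M2 H2].
  exists (M1 + M2)%nat. intros M z HM Hz.
  pose proof (H1 M z ltac:(lia) Hz) as K1. pose proof (H2 M z ltac:(lia) Hz) as K2.
  replace (phi z + e * psi z - sum_n (fun k => (c k + e * b k) * z ^ k) M)%C with
    ((phi z - sum_n (fun k => c k * z ^ k) M) + e * (psi z - sum_n (fun k => b k * z ^ k) M))%C.
  - eapply Rle_trans; [apply Cmod_triangle|]. rewrite Cmod_mult, He. lra.
  - transitivity (phi z + e * psi z + (- (1)) *
      (sum_n (fun k => c k * z ^ k) M + e * sum_n (fun k => b k * z ^ k) M))%C; [cring|].
    rewrite <- sum_n_scal_C, <- sum_n_plus_C.
    rewrite (sum_n_ext_C (fun k => c k * z ^ k + e * (b k * z ^ k))%C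
      (fun k => (c k + e * b k) * z ^ k)%C) by (intros; ring). cring.
Qed.

(** * The class of the theorem *)

Lemma Defs_Cmod (z : C) : Defs.Cmod z = Cmod z.
Proof. unfold Defs.Cmod, Cmod. f_equal. ring. Qed.

Lemma Defs_Cinv (z : C) : Defs.Cinv z = Cinv z.
Proof.
  unfold Defs.Cinv, Cinv.
  replace (fst z * fst z + snd z * snd z) with (fst z ^ 2 + snd z ^ 2) by ring. reflexivity.
Qed.

Lemma Defs_Cpow (z : C) (n : nat) : Defs.Cpow z n = (z ^ n)%C.
Proof.
  induction n as [|n IH]; [reflexivity|]. rewrite Cpow_S, <- IH. reflexivity.
Qed.

Lemma Cderiv_at_cderiv (f : C -> C) (z l : C) : Cderiv_at f z l -> cderiv f z l.
Proof.
  intros H eps Heps. destruct (H eps Heps) as [d [Hd Hw]]. exists d. split; [exact Hd|].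
  intros w Hlt. destruct (Ceq_dec w 0) as [-> | Hne].
  - rewrite Cplus_0_r. replace (f z - f z - l * 0)%C with (RtoC 0) by ring.
    rewrite Cmod_0. lra.
  - assert (Hpos : 0 < Cmod w) by now apply Cmod_gt_0.
    specialize (Hw w). rewrite !Defs_Cmod in Hw. specialize (Hw (conj Hpos Hlt)).
    unfold Defs.Cdiv in Hw. rewrite Defs_Cinv in Hw.
    change (Cmod ((f (z + w)%C - f z) * / w - l)%C < eps) in Hw.
    replace (f (z + w)%C - f z - l * w)%C with (((f (z + w)%C - f z) * / w - l) * w)%C
      by (field; exact Hne).
    rewrite Cmod_mult. apply Rmult_le_compat_r; lra.
Qed.

(** The nested tests mirror those of [Csum]. *)
Definition window (a : nat -> C) (lo hi k : nat) : C :=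
  if (lo <=? k)%nat then if (k <=? hi)%nat then a k else RtoC 0 else RtoC 0.

Lemma window_in (a : nat -> C) (lo hi k : nat) : (lo <= k <= hi)%nat -> window a lo hi k = a k.
Proof.
  intros [H1 H2]. unfold window. apply Nat.leb_le in H1, H2. now rewrite H1, H2.
Qed.

Lemma window_out (a : nat -> C) (lo hi k : nat) :
  (k < lo \/ hi < k)%nat -> window a lo hi k = RtoC 0.
Proof.
  intros H. unfold window.
  destruct (Nat.leb_spec lo k), (Nat.leb_spec k hi); try reflexivity; lia.
Qed.

(** Any upper limit n >= hi is allowed, so that two sections of different lengths share one range of
    summation. *)
Lemma Csum_window (a : nat -> C) (z : C) (lo hi n : nat) : (hi <= n)%nat ->
  Csum lo hi (fun k => Cmul (a k) (Defs.Cpow z k)) =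
  sum_n (fun k => window a lo hi k * z ^ k)%C n.
Proof.
  intros Hn. unfold Csum.
  set (F := fun k => if Nat.leb lo k then if Nat.leb k hi then
     Cmul (a k) (Defs.Cpow z k) else (0, 0) else (0, 0)).
  assert (E : forall k, F k = (window a lo hi k * z ^ k)%C).
  { intros k. unfold F, window. rewrite Defs_Cpow.
    destruct (lo <=? k)%nat, (k <=? hi)%nat; try reflexivity;
      (change (0, 0) with (RtoC 0); now rewrite Cmult_0_l). }
  assert (E1 : forall m, Csum_upto F m = sum_n (fun k => window a lo hi k * z ^ k)%C m).
  { induction m as [|m IH].
    - rewrite sum_O. apply E.
    - rewrite sum_n_SC, <- IH, <- E. reflexivity. }
  rewrite E1. induction Hn as [|m Hm IH]; [reflexivity|].
  rewrite sum_n_SC, <- IH, window_out, Cmult_0_l, Cplus_0_r by lia. reflexivity.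
Qed.

Lemma s_pq_hpoly (a b : nat -> C) (p q n : nat) (z : C) : (p <= n)%nat -> (q <= n)%nat ->
  s_pq a b p q z = hpoly (window a 2 p) (window b 2 q) n z.
Proof.
  intros Hp Hq. unfold s_pq, s_sec, s_sec0.
  rewrite (Csum_window a z 2 p n Hp), (Csum_window b z 2 q n Hq).
  unfold hpoly. rewrite sum_n_plus_C, <- Cconj_sum_n, Cplus_assoc. reflexivity.
Qed.

(** The full Taylor sequence, including orders 0 and 1: [a1] is 1 for h and 0 for g. *)
Definition normalized (a : nat -> C) (a1 : C) (k : nat) : C :=
  match k with O => RtoC 0 | S O => a1 | _ => a k end.

Lemma normalized_converges (a : nat -> C) (a1 : C) (F : C -> C) :
  (forall z, inD z -> series_conv_to
     (fun n => Cplus (a1 * z) (Csum 2 n (fun k => Cmul (a k) (Defs.Cpow z k)))) (F z)) ->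
  converges_to (normalized a a1) F.
Proof.
  intros H z Hz eps Heps. unfold inD in H. specialize (H z). rewrite Defs_Cmod in H.
  destruct (H Hz eps Heps) as [N HN]. exists (S N). intros n Hn.
  specialize (HN n ltac:(lia)). rewrite Defs_Cmod in HN.
  rewrite (Csum_window a z 2 n n (le_n n)) in HN.
  assert (E : sum_n (fun k => normalized a a1 k * z ^ k)%C n =
    (a1 * z + sum_n (fun k => window a 2 n k * z ^ k) n)%C).
  { assert (G : forall m, (1 <= m <= n)%nat ->
      sum_n (fun k => normalized a a1 k * z ^ k)%C m =
      (a1 * z + sum_n (fun k => window a 2 n k * z ^ k) m)%C).
    { induction m as [|m IH]; intros Hm; [lia|].
      rewrite !sum_n_SC. destruct m as [|m].
      - rewrite !sum_O. simpl. unfold window; simpl. cring.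
      - rewrite IH, window_in by lia. simpl normalized. cring. }
    apply G. lia. }
  rewrite E. exact HN.
Qed.

(** The factors 1 and 3/2 are k/2 for k = 2, 3: the derivative has coefficients k a_k, and each
    trigonometric moment is halved. *)
Definition coefficient_estimates (gamma : R) (a b : nat -> C) : Prop :=
  (forall (e t1 t2 : C) (t0 : R), Cmod e = 1 ->
     (forall x, Cmod x = 1 -> 0 <= t0 + Re (t1 * x) + Re (t2 * x ^ 2)) ->
     0 <= t0 * gamma + Re (t1 * (a 2%nat + e * b 2%nat))
        + 3 / 2 * Re (t2 * (a 3%nat + e * b 3%nat))) /\
  (forall k, (2 <= k)%nat -> INR k * (Cmod (a k) + Cmod (b k)) <= 2 * gamma) /\
  (forall k, (2 <= k)%nat -> INR k * Cmod (b k) <= gamma).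

Lemma expands_minus_const (phi : C -> C) (c c' : nat -> C) (beta : R) :
  expands phi c -> c' 0%nat = (c 0%nat - RtoC beta)%C -> (forall k, c' (S k) = c (S k)) ->
  expands (fun z => phi z - RtoC beta)%C c'.
Proof.
  intros H H0 HS rho eta Hr He. destruct (H rho eta Hr He) as [M0 HM].
  exists M0. intros M z HMM Hz.
  assert (E : sum_n (fun k => c' k * z ^ k)%C M =
    (sum_n (fun k => c k * z ^ k) M - RtoC beta)%C).
  { clear - H0 HS. induction M as [|M IH].
    - rewrite !sum_O, H0. simpl. ring.
    - rewrite !sum_n_SC, IH, HS. cring. }
  rewrite E. replace (_ - _)%C with (phi z - sum_n (fun k => c k * z ^ k) M)%C by cring.
  now apply HM.
Qed.

Lemma WH0_coefficient_estimates (alpha beta : R) (a b : nat -> C) (h g : C -> C) :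
  0 <= alpha -> in_WH0 alpha beta a b h g -> coefficient_estimates (1 - beta) a b.
Proof.
  intros Ha [HH [h1 [h2 [g1 [g2 [Hd Hineq]]]]]].
  assert (HD : forall z : C, Cmod z < 1 -> inD z).
  { intros z Hz. unfold inD. rewrite Defs_Cmod. exact Hz. }
  (* Fixing e replaces the modulus by a rotated real part and leaves the single analytic function h'
     + e g', to which the argument on rays applies. *)
  assert (Hpos : forall e z, Cmod e = 1 -> Cmod z < 1 -> beta < Re (h1 z + e * g1 z)).
  { intros e z He.
    apply (re_lower_bound_on_rays alpha beta (fun z => h1 z + e * g1 z)%C
             (fun z => h2 z + e * g2 z)%C Ha).
    - intros w Hw. destruct (Hd w (HD w Hw)) as [_ [D1 [_ D2]]].
      apply cderiv_plus_mult; [exact He | now apply Cderiv_at_cderiv ..].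
    - intros w Hw. pose proof (Hineq w (HD w Hw)) as Hi. rewrite Defs_Cmod in Hi.
      change (Re (h1 w + RtoC alpha * (w * h2 w) - RtoC beta)%C
              > Cmod (g1 w + RtoC alpha * (w * g2 w))%C) in Hi.
      rewrite re_minus, re_RtoC in Hi.
      replace (h1 w + e * g1 w + RtoC alpha * (w * (h2 w + e * g2 w)))%C with
        (h1 w + RtoC alpha * (w * h2 w) + e * (g1 w + RtoC alpha * (w * g2 w)))%C by ring.
      rewrite re_plus. pose proof (re_ge (e * (g1 w + RtoC alpha * (w * g2 w)))%C) as Hge.
      rewrite Cmod_mult, He in Hge. lra. }
  assert (Eh : expands h1 (fun k => RtoC (INR (S k)) * normalized a 1 (S k))%C).
  { apply derivative_expands with h.
    - apply normalized_converges. intros z Hz. rewrite Cmult_1_l. apply (HH z Hz).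
    - intros z Hz. apply Cderiv_at_cderiv, (Hd z (HD z Hz)). }
  assert (Eg : expands g1 (fun k => RtoC (INR (S k)) * normalized b 0 (S k))%C).
  { apply derivative_expands with g.
    - apply normalized_converges. intros z Hz. rewrite Cmult_0_l.
      intros eps Heps. destruct (proj2 (HH z Hz) eps Heps) as [N HN].
      exists N. intros n Hn. rewrite Cplus_0_l. now apply HN.
    - intros z Hz. apply Cderiv_at_cderiv, (Hd z (HD z Hz)). }
  (* [c] and [d] list the coefficients of h' - beta and of g', hence the index shift and the
     constant term 1 - beta. *)
  set (c := fun k => match k with O => RtoC (1 - beta)
     | S _ => (RtoC (INR (S k)) * normalized a 1 (S k))%C end).
  set (d := fun k => (RtoC (INR (S k)) * normalized b 0 (S k))%C) in Eg.
  assert (Ec : expands (fun z => h1 z - RtoC beta)%C c).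
  { apply (expands_minus_const _ _ _ _ Eh); [|reflexivity].
    unfold c, normalized. simpl INR. rewrite RtoC_minus. ring. }
  assert (Ee : forall e, Cmod e = 1 ->
     expands (fun z => (h1 z - RtoC beta) + e * g1 z)%C (fun k => c k + e * d k)%C).
  { intros e He. now apply expands_pencil. }
  assert (E0 : forall e, (c 0%nat + e * d 0%nat)%C = RtoC (1 - beta)).
  { intros e. unfold c, d, normalized. ring. }
  assert (Hnn : forall e, Cmod e = 1 -> forall z, Cmod z < 1 ->
     0 <= Re ((h1 z - RtoC beta) + e * g1 z)%C).
  { intros e He z Hz. pose proof (Hpos e z He Hz) as Hp.
    rewrite re_plus in *. rewrite re_minus, re_RtoC. lra. }
  assert (Hdom : forall z, Cmod z < 1 -> Cmod (g1 z) <= Re (h1 z - RtoC beta)).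
  { intros z Hz. destruct (unit_direction (g1 z)) as [e [He E]].
    pose proof (Hnn (- e)%C ltac:(now rewrite Cmod_opp) z Hz) as Hp.
    replace (- e * g1 z)%C with (- (e * g1 z))%C in Hp by ring.
    rewrite E, re_plus, re_opp, re_RtoC in Hp. lra. }
  assert (Hcd : forall k, c (S k) = (RtoC (INR (S (S k))) * a (S (S k)))%C /\
                          d (S k) = (RtoC (INR (S (S k))) * b (S (S k)))%C)
    by (intros; split; reflexivity).
  split; [|split].
  - intros e t1 t2 t0 He HT.
    pose proof (trig_nonneg _ _ (1 - beta) t0 t1 t2 1 2 (Ee e He) (E0 e) (Hnn e He)
      ltac:(lia) ltac:(lia)) as Ht.
    destruct (Hcd 0%nat) as [C1 D1]. destruct (Hcd 1%nat) as [C2 D2].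
    cbv beta in Ht. rewrite C1, D1, C2, D2 in Ht.
    replace (t1 * (RtoC (INR 2) * a 2%nat + e * (RtoC (INR 2) * b 2%nat)))%C with
      (RtoC (INR 2) * (t1 * (a 2%nat + e * b 2%nat)))%C in Ht by ring.
    replace (t2 * (RtoC (INR 3) * a 3%nat + e * (RtoC (INR 3) * b 3%nat)))%C with
      (RtoC (INR 3) * (t2 * (a 3%nat + e * b 3%nat)))%C in Ht by ring.
    rewrite !re_scal_l in Ht. simpl INR in Ht.
    specialize (Ht ltac:(intros x Hx; rewrite Cpow_1_r; now apply HT)). lra.
  - intros [|[|k]] Hk; [lia | lia |].
    destruct (Hcd k) as [C1 D1].
    destruct (unit_direction (a (S (S k)))) as [e1 [He1 E1]].
    destruct (unit_direction (b (S (S k)))) as [e2 [He2 E2]].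
    assert (Hne : e1 <> 0%C) by (intros Z; rewrite Z, Cmod_0 in He1; lra).
    (* This e aligns e b_k with a_k, so that |a_k + e b_k| = |a_k| + |b_k|. *)
    set (e := (/ e1 * e2)%C).
    assert (He : Cmod e = 1) by (unfold e; rewrite Cmod_mult, Cmod_inv, He1, He2 by exact Hne; lra).
    pose proof (caratheodory_bound _ _ (1 - beta) (S k) (Ee e He) (E0 e) (Hnn e He) ltac:(lia)) as Hb.
    cbv beta in Hb. rewrite C1, D1 in Hb.
    replace (RtoC (INR (S (S k))) * a (S (S k)) + e * (RtoC (INR (S (S k))) * b (S (S k))))%C with
      (RtoC (INR (S (S k))) * (/ e1 * (e1 * a (S (S k)) + e2 * b (S (S k)))))%C in Hb
      by (unfold e; field; exact Hne).
    rewrite E1, E2, <- RtoC_plus, Cmod_INR_mult, Cmod_mult, Cmod_inv, He1, Cmod_R, Rabs_pos_eq in Hb;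
      [lra | | exact Hne].
    pose proof (Cmod_ge_0 (a (S (S k)))). pose proof (Cmod_ge_0 (b (S (S k)))). lra.
  - intros [|[|k]] Hk; [lia | lia |].
    pose proof (subordinate_bound _ _ c d (1 - beta) (S k) Ec Eg eq_refl Hdom) as Hb.
    rewrite (proj2 (Hcd k)), Cmod_INR_mult in Hb. exact Hb.
Qed.

(** * Estimates for the sections *)

Lemma sum_INR_pow_le (r : R) (n : nat) : 0 <= r < 1 ->
  sum_n (fun k => INR k * r ^ pred k) n <= 1 / (1 - r) ^ 2.
Proof.
  intros Hr.
  assert (E : sum_n (fun k => INR k * r ^ pred k) n * (1 - r) ^ 2 =
     1 - r ^ n - INR n * r ^ n * (1 - r)).
  { induction n as [|n IH].
    - rewrite sum_O. simpl. ring.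
    - rewrite sum_n_SR, Rmult_plus_distr_r, IH, S_INR. simpl pred. simpl (r ^ S n). ring. }
  apply Rle_div_r; [nra|]. rewrite E.
  assert (0 <= r ^ n) by (apply pow_le; lra). pose proof (pos_INR n).
  assert (0 <= INR n * r ^ n * (1 - r)) by (repeat apply Rmult_le_pos; lra). lra.
Qed.

(** The sum of k r^(k-1) over k >= 3; [tail4] is the one over k >= 4. *)
Definition tail3 (r : R) : R := 1 / (1 - r) ^ 2 - 1 - 2 * r.
Definition tail4 (r : R) : R := tail3 r - 3 * r ^ 2.

Lemma tail3_nonneg (r : R) : 0 <= r < 1 -> 0 <= tail3 r.
Proof.
  intros Hr. unfold tail3.
  replace (1 / (1 - r) ^ 2 - 1 - 2 * r) with (r ^ 2 * (3 - 2 * r) / (1 - r) ^ 2) by (field; lra).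
  apply Rdiv_le_0_compat; nra.
Qed.

(** [tail4 r] equals r^3 (4 - 3 r) / (1 - r)^2. The later constants 563/100 and 559/100 round up the
    quotient (4 - 3 r) / (1 - r)^2 at r = 234/1000 and r = 23/100. *)
Lemma tail4_le (r c : R) : 0 <= r < 1 -> 4 - 3 * r <= c * (1 - r) ^ 2 -> tail4 r <= c * r ^ 3.
Proof.
  intros Hr Hc. unfold tail4, tail3.
  replace (1 / (1 - r) ^ 2 - 1 - 2 * r - 3 * r ^ 2) with
    (r ^ 3 * ((4 - 3 * r) / (1 - r) ^ 2)) by (field; lra).
  rewrite Rmult_comm. apply Rmult_le_compat_r; [apply pow_le; lra|].
  apply Rle_div_l; [nra | exact Hc].
Qed.

Lemma tail3_incr (r s : R) : 0 <= r <= s -> s < 1 -> tail3 r + 2 * r <= tail3 s + 2 * s.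
Proof.
  intros Hrs Hs. unfold tail3. assert (1 / (1 - r) ^ 2 <= 1 / (1 - s) ^ 2); [|lra].
  apply Rmult_le_compat_l; [lra|]. apply Rinv_le_contravar; nra.
Qed.

Lemma sum_n_head_bound (u : nat -> R) (m2 m3 r : R) (n : nat) :
  0 <= r < 1 -> 0 <= m3 -> (2 <= n)%nat -> u 0%nat = 0 -> u 1%nat = 0 -> u 2%nat <= m2 * r ->
  (forall k, (3 <= k)%nat -> u k <= m3 * (INR k * r ^ pred k)) ->
  sum_n u n <= m2 * r + m3 * tail3 r.
Proof.
  intros Hr Hm Hn H0 H1 H2 Hu. set (G := sum_n (fun k => INR k * r ^ pred k)).
  apply Rle_trans with (m2 * r + m3 * (G n - (1 + 2 * r))).
  - induction Hn as [|n Hn IH].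
    + unfold G. rewrite !sum_n_SR, !sum_O, H0, H1. simpl. lra.
    + unfold G in *. rewrite !sum_n_SR. pose proof (Hu (S n) ltac:(lia)). lra.
  - pose proof (sum_INR_pow_le r n Hr). unfold tail3.
    apply Rplus_le_compat_l, Rmult_le_compat_l; [exact Hm | unfold G; lra].
Qed.

(** The factor that 2 F' + z F'' + e z F'' puts on the term k D_k z^(k-1) of F'. *)
Definition weight (e : C) (k : nat) : C :=
  (2 + RtoC (INR (pred k)) + RtoC (INR (pred k)) * e)%C.

Definition wterm (e : C) (D : nat -> C) (z : C) (k : nat) : C :=
  (weight e k * (RtoC (INR k) * D k * z ^ pred k))%C.

Lemma Cmod_weight_le (e : C) (k : nat) : Cmod e = 1 -> (1 <= k)%nat ->
  Cmod (weight e k) <= 2 * INR k.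
Proof.
  intros He Hk. unfold weight. destruct k as [|k]; [lia|]. simpl pred. rewrite S_INR.
  eapply Rle_trans; [apply Cmod_triangle|]. rewrite Cmod_INR_mult, He.
  eapply Rle_trans; [apply Rplus_le_compat_r, Cmod_triangle|].
  rewrite !Cmod_R, !Rabs_pos_eq by (try apply pos_INR; lra). lra.
Qed.

(* [Re (2 F' + z F'') >= |z F''|] is implied by the linear conditions
   [Re (2 F' + z F'' + e z F'') >= 0] for all unimodular [e]. *)
Lemma convex_bound_of_linear (D : nat -> C) (n : nat) (z : C) :
  (forall e, Cmod e = 1 -> 0 <= 2 + Re (sum_n (wterm e D z) n)) ->
  Cmod (zddpoly D n z) <= Re (2 * (1 + dpoly D n z) + zddpoly D n z).
Proof.
  intros H. destruct (unit_direction (zddpoly D n z)) as [e [He E]].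
  specialize (H (- e)%C ltac:(now rewrite Cmod_opp)).
  assert (Es : sum_n (wterm (- e) D z) n =
    (2 * dpoly D n z + (zddpoly D n z + (- e) * zddpoly D n z))%C).
  { unfold dpoly, zddpoly. rewrite <- !sum_n_scal_C, <- !sum_n_plus_C.
    apply sum_n_ext_C. intros k. unfold wterm, weight. ring. }
  rewrite Es in H.
  replace (- e * zddpoly D n z)%C with (- (e * zddpoly D n z))%C in H by ring.
  rewrite E, !re_plus, re_opp, re_RtoC in H.
  replace (2 * (1 + dpoly D n z) + zddpoly D n z)%C with
    (RtoC 2 + (2 * dpoly D n z + zddpoly D n z))%C by ring.
  rewrite !re_plus, re_RtoC. lra.
Qed.

Lemma Cmod_wterm_le (e : C) (D : nat -> C) (z : C) (r m : R) (k : nat) :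
  Cmod e = 1 -> Cmod z = r -> (1 <= k)%nat -> INR k * Cmod (D k) <= m ->
  Cmod (wterm e D z k) <= 2 * m * (INR k * r ^ pred k).
Proof.
  intros He Hz Hk HD. unfold wterm. rewrite !Cmod_mult, Cmod_pow, Hz.
  rewrite Cmod_R, Rabs_pos_eq by apply pos_INR.
  pose proof (Cmod_weight_le e k He Hk).
  assert (0 <= r ^ pred k) by (apply pow_le; rewrite <- Hz; apply Cmod_ge_0).
  apply Rle_trans with (2 * INR k * (m * r ^ pred k)); [|lra].
  apply Rmult_le_compat; [apply Cmod_ge_0 | | exact H |].
  - apply Rmult_le_pos; [apply Rmult_le_pos; [apply pos_INR | apply Cmod_ge_0] | assumption].
  - now apply Rmult_le_compat_r.
Qed.

Lemma Re_sum_wterm_ge (e : C) (D : nat -> C) (z : C) (r m : R) (n : nat) :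
  Cmod e = 1 -> Cmod z = r -> 0 <= r < 1 -> 0 <= m -> (3 <= n)%nat ->
  D 0%nat = RtoC 0 -> D 1%nat = RtoC 0 ->
  (forall k, (4 <= k)%nat -> INR k * Cmod (D k) <= m) ->
  Re (wterm e D z 2) + Re (wterm e D z 3) - 2 * m * tail4 r <= Re (sum_n (wterm e D z) n).
Proof.
  intros He Hz Hr Hm Hn H0 H1 HD. set (G := sum_n (fun k => INR k * r ^ pred k)).
  apply Rle_trans with (Re (wterm e D z 2) + Re (wterm e D z 3)
    - 2 * m * (G n - (1 + 2 * r + 3 * r ^ 2))).
  - pose proof (sum_INR_pow_le r n Hr). unfold tail4, tail3.
    apply Rplus_le_compat_l, Ropp_le_contravar, Rmult_le_compat_l; [lra | unfold G; lra].
  - induction Hn as [|n Hn IH].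
    + unfold G. rewrite !sum_n_SC, !sum_n_SR, !sum_O, !re_plus.
      assert (E : forall k, D k = RtoC 0 -> wterm e D z k = RtoC 0).
      { intros k E. unfold wterm. rewrite E. ring. }
      rewrite (E 0%nat H0), (E 1%nat H1), re_RtoC. simpl INR. simpl pred. simpl pow. lra.
    + rewrite sum_n_SC, re_plus. unfold G in *. rewrite sum_n_SR.
      pose proof (Cmod_wterm_le e D z r m (S n) He Hz ltac:(lia) (HD (S n) ltac:(lia))).
      pose proof (re_ge (wterm e D z (S n))). lra.
Qed.

(** * Trigonometric polynomials for the terms of order 2 and 3 *)

Lemma wterm_2 (e : C) (D : nat -> C) (z : C) :
  wterm e D z 2 = (2 * (3 + e) * z * D 2%nat)%C.
Proof.
  unfold wterm, weight. simpl INR. simpl pred. rewrite !Cpow_1_r.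
  replace (RtoC (1 + 1)) with (RtoC 2) by (f_equal; lra). ring.
Qed.

Lemma wterm_3 (e : C) (D : nat -> C) (z : C) :
  wterm e D z 3 = (3 * (4 + 2 * e) * z ^ 2 * D 3%nat)%C.
Proof.
  unfold wterm, weight. simpl INR. simpl pred.
  replace (RtoC (1 + 1 + 1)) with (RtoC 3) by (f_equal; lra).
  replace (RtoC (1 + 1)) with (RtoC 2) by (f_equal; lra). ring.
Qed.

Lemma Cmod_4_2e (e : C) : Cmod e = 1 -> Cmod (4 + 2 * e) <= 6.
Proof.
  intros He. eapply Rle_trans; [apply Cmod_triangle|].
  rewrite Cmod_mult, !Cmod_R, He, !Rabs_pos_eq by lra. lra.
Qed.

(** The arithmetic-geometric mean inequality, with s a guess for |y|: it trades |y| for |y|^2, which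
    will be a polynomial in [Re x]. *)
Lemma Re_unit_mult_ge (e y : C) (s : R) : Cmod e = 1 -> 0 < s ->
  - ((Cmod y ^ 2 + s ^ 2) / (2 * s)) <= Re (e * y).
Proof.
  intros He Hs. pose proof (re_ge (e * y)) as H. rewrite Cmod_mult, He in H.
  assert (Cmod y <= (Cmod y ^ 2 + s ^ 2) / (2 * s)); [|lra].
  apply (proj1 (Rle_div_r (Cmod y) (Cmod y ^ 2 + s ^ 2) (2 * s) ltac:(lra))).
  pose proof (pow2_ge_0 (Cmod y - s)). lra.
Qed.

Lemma unit_re_im (x : C) : Cmod x = 1 -> Re x ^ 2 + Im x ^ 2 = 1.
Proof. intros H. rewrite <- Cmod2_alt, H. ring. Qed.

(** What remains of [trig_bound_h] in the variable y = r Re x; for instance 2752/100 is 4 times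
    563/100 plus 5. The square completed is that of 16 y^2 + (6 - 5 r) y. *)
Lemma trig_h_poly (r y : R) : 0 <= r <= 234 / 1000 ->
  0 <= 2 + 6 * y + 16 * y ^ 2 - 5 * r * y - 205 / 100 * r - 14 * r ^ 2 - 2752 / 100 * r ^ 3.
Proof.
  intros Hr. pose proof (pow2_ge_0 (y + (6 - 5 * r) / 32)).
  assert (r ^ 2 <= 234 / 1000 * r) by nra.
  assert (r ^ 3 <= 54756 / 1000000 * r).
  { replace (r ^ 3) with (r ^ 2 * r) by ring. apply Rmult_le_compat_r; nra. }
  lra.
Qed.

(** In the constant, 6 r^2 pays for the b_3 that the section lacks and 4 [tail4 r] for the orders
    from 4 on, where k |D_k| <= 2 gamma. *)
Lemma trig_bound_h (r : R) (e x : C) : 0 <= r <= 234 / 1000 -> Cmod e = 1 -> Cmod x = 1 ->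
  0 <= (2 - 6 * r ^ 2 - 4 * tail4 r) + Re (2 * (3 + e) * RtoC r * x)
       + Re (2 * (4 + 2 * e) * RtoC r ^ 2 * x ^ 2).
Proof.
  intros Hr He Hx.
  assert (Ht : tail4 r <= 563 / 100 * r ^ 3) by (apply tail4_le; nra).
  pose proof (unit_re_im x Hx) as Hxy.
  assert (Ex : (x * x)%C = (RtoC 2 * RtoC (Re x) * x - 1)%C).
  { destruct x as [p q]; simpl in Hxy. apply C_ext; simpl; [nra | ring]. }
  replace (2 * (3 + e) * RtoC r * x)%C with
    (RtoC (6 * r) * x + RtoC (2 * r) * (e * x))%C by (rewrite !RtoC_mult; ring).
  replace (2 * (4 + 2 * e) * RtoC r ^ 2 * x ^ 2)%C with
    (RtoC (8 * r ^ 2) * (x * x) + RtoC (2 * r) * (e * (RtoC (2 * r) * (x * x))))%C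
    by (rewrite !RtoC_mult, RtoC_pow; ring).
  rewrite !re_plus, !re_scal_l.
  assert (H2 : Re (x * x) = 2 * Re x ^ 2 - 1) by (rewrite re_mult; nra).
  (* 4/5 is about |1 + 2 r x| for r = 234/1000 at the minimum of the resulting quadratic in r Re
     x. *)
  pose proof (Re_unit_mult_ge e (x + RtoC (2 * r) * (x * x)) (4 / 5) He ltac:(lra)) as HV.
  assert (EV : Cmod (x + RtoC (2 * r) * (x * x)) ^ 2 = 1 + 4 * r * Re x + 4 * r ^ 2).
  { replace (x + RtoC (2 * r) * (x * x))%C with (x * (1 + RtoC (2 * r) * x))%C by ring.
    rewrite Cmod_mult, Hx, Rmult_1_l, Cmod2_alt, re_plus, im_plus, re_scal_l, im_scal_l.
    simpl (Re 1). simpl (Im 1). clear Ex H2 HV. nra. }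
  rewrite EV, Cmult_plus_distr_l, re_plus in HV. rewrite H2.
  set (X := Re x) in *. set (V1 := Re (e * x)) in *.
  set (V2 := Re (e * (RtoC (2 * r) * (x * x)))) in *. clearbody V1 V2.
  assert (HV' : - (2 * r * ((1 + 4 * r * X + 4 * r ^ 2 + (4 / 5) ^ 2) / (2 * (4 / 5))))
    <= 2 * r * (V1 + V2)) by nra.
  pose proof (trig_h_poly r (r * X) Hr) as Hq.
  nra.
Qed.

(** The order 2 term has half the weight used for [trig_bound_h], since only half of a_3 + e b_3 is
    kept when b_3 is isolated; the tail is halved because only k |b_k| <= gamma occurs there. *)
Lemma trig_bound_g (r : R) (e x : C) : 0 <= r <= 23 / 100 -> Cmod e = 1 -> Cmod x = 1 ->
  0 <= (2 - 6 * r ^ 2 - 2 * tail4 r) + Re (2 * (3 + e) * RtoC r * x)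
       + Re ((4 + 2 * e) * RtoC r ^ 2 * x ^ 2).
Proof.
  intros Hr He Hx.
  assert (Ht : tail4 r <= 559 / 100 * r ^ 3) by (apply tail4_le; nra).
  pose proof (unit_re_im x Hx) as Hxy.
  replace (2 * (3 + e) * RtoC r * x)%C with
    (RtoC (6 * r) * x + RtoC (2 * r) * (e * x))%C by (rewrite !RtoC_mult; ring).
  replace ((4 + 2 * e) * RtoC r ^ 2 * x ^ 2)%C with
    (RtoC (4 * r ^ 2) * (x * x) + RtoC (2 * r) * (e * (RtoC r * (x * x))))%C
    by (rewrite !RtoC_mult, RtoC_pow; ring).
  rewrite !re_plus, !re_scal_l.
  assert (H2 : Re (x * x) = 2 * Re x ^ 2 - 1) by (rewrite re_mult; nra).
  (* 1 - r is the exact value of |x + r x^2| at x = -1, the critical point. *)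
  pose proof (Re_unit_mult_ge e (x + RtoC r * (x * x)) (1 - r) He ltac:(lra)) as HV.
  assert (EV : Cmod (x + RtoC r * (x * x)) ^ 2 = 1 + 2 * r * Re x + r ^ 2).
  { replace (x + RtoC r * (x * x))%C with (x * (1 + RtoC r * x))%C by ring.
    rewrite Cmod_mult, Hx, Rmult_1_l, Cmod2_alt, re_plus, im_plus, re_scal_l, im_scal_l.
    simpl (Re 1). simpl (Im 1). clear H2 HV. nra. }
  rewrite EV, Cmult_plus_distr_l, re_plus in HV. rewrite H2.
  assert (HX : -1 <= Re x <= 1) by nra.
  set (X := Re x) in *. set (V1 := Re (e * x)) in *.
  set (V2 := Re (e * (RtoC r * (x * x)))) in *. clearbody V1 V2 X.
  (* The left side is (1 - r) + r (1 + X) / (1 - r), and 1 / (1 - r) <= 13/10. *)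
  assert (HB : (1 + 2 * r * X + r ^ 2 + (1 - r) ^ 2) / (2 * (1 - r)) <=
     (1 - r) + 13 / 10 * r * (1 + X)).
  { apply Rle_div_l; [lra|]. assert (0 <= r * (1 + X)) by nra. nra. }
  assert (HV' : - (2 * r * ((1 - r) + 13 / 10 * r * (1 + X))) <= 2 * r * (V1 + V2)) by nra.
  set (Y := 1 + X) in *. replace X with (Y - 1) by (unfold Y; ring).
  assert (HY : 0 <= Y <= 2) by (unfold Y; lra). clearbody Y.
  assert (Hr3 : r ^ 3 <= 529 / 10000 * r).
  { replace (r ^ 3) with (r ^ 2 * r) by ring. apply Rmult_le_compat_r; nra. }
  (* In powers of Y = 1 + Re x, [H1], [H3] and [H4] are the constant, linear and quadratic parts.
     [H1] is what limits r to about 23/100. *)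
  assert (H1 : 0 <= 2 - 8 * r - 1118 / 100 * r ^ 3) by lra.
  assert (H3 : 0 <= Y * (r * (6 - 16 * r - 26 / 10 * r))) by (apply Rmult_le_pos; nra).
  assert (H4 : 0 <= 8 * r ^ 2 * Y ^ 2) by nra.
  nra.
Qed.

(** * The convexity criterion for both kinds of section *)

Section Criterion.

Variables (gamma : R) (a b : nat -> C).
Hypothesis gamma_range : 0 < gamma <= 1.
Hypothesis coeffs : coefficient_estimates gamma a b.

Let A (p : nat) := window a 2 p.
Let B (q : nat) := window b 2 q.

Lemma window_bound (p q k : nat) :
  INR k * (Cmod (A p k) + Cmod (B q k)) <= 2 * gamma.
Proof.
  destruct coeffs as [_ [H2 _]]. unfold A, B, window. pose proof (pos_INR k).
  destruct (Nat.leb_spec 2 k) as [Hk | Hk].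
  - specialize (H2 k Hk). pose proof (Cmod_ge_0 (a k)). pose proof (Cmod_ge_0 (b k)).
    destruct (k <=? p)%nat, (k <=? q)%nat; rewrite ?Cmod_0; nra.
  - rewrite Cmod_0. lra.
Qed.

Lemma window_bound_g (q k : nat) : INR k * Cmod (B q k) <= gamma.
Proof.
  destruct coeffs as [_ [_ H3]]. unfold B, window.
  destruct (Nat.leb_spec 2 k) as [Hk | Hk]; [|rewrite Cmod_0; lra].
  destruct (k <=? q)%nat; [now apply H3 | rewrite Cmod_0; lra].
Qed.

Lemma sum_window_bound (p q n : nat) (m r : R) :
  0 < r < 1 -> (2 <= n)%nat -> 0 <= m ->
  (forall k, (3 <= k)%nat -> Cmod (A p k) + Cmod (B q k) <= m) ->
  sum_n (fun k => INR k * (Cmod (A p k) + Cmod (B q k)) * r ^ pred k) n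
    <= 2 * gamma * r + m * tail3 r.
Proof.
  intros Hr Hn Hm H3. apply sum_n_head_bound; [lra | exact Hm | exact Hn | | | |].
  - unfold A, B. rewrite !window_out by lia. rewrite Cmod_0. simpl. ring.
  - unfold A, B. rewrite !window_out by lia. rewrite Cmod_0. simpl. ring.
  - simpl pred. rewrite pow_1. apply Rmult_le_compat_r; [lra | apply window_bound].
  - intros k Hk. pose proof (pow_le r (pred k) ltac:(lra)). pose proof (pos_INR k).
    specialize (H3 k Hk).
    apply Rle_trans with (INR k * m * r ^ pred k); [|lra].
    apply Rmult_le_compat_r; [assumption|]. now apply Rmult_le_compat_l.
Qed.

Lemma unit_part (z : C) (r : R) : 0 < r -> Cmod z = r ->
  exists x, Cmod x = 1 /\ z = (RtoC r * x)%C.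
Proof.
  intros Hr Hz. destruct (polar_from z r 0 Hr Hz) as [t [_ ->]].
  exists (cis t). split; [apply Cmod_cis | reflexivity].
Qed.

Lemma criterion_h (p : nat) (r : R) : (3 <= p)%nat -> 0 < r <= 234 / 1000 ->
  convex_criterion (A p) (B 2) p r.
Proof.
  intros Hp Hr. split.
  - exists (2 * gamma * r + 1 * tail3 r).
    assert (Ht : tail4 r <= 563 / 100 * r ^ 3) by (apply tail4_le; nra).
    pose proof (tail3_nonneg r ltac:(lra)) as H0.
    split; [|apply sum_window_bound; [lra | lia | lra |]].
    + unfold tail4 in Ht. split; [nra|].
      assert (r ^ 2 <= 234 / 1000 * r) by nra.
      assert (r ^ 3 <= 54756 / 1000000 * r).
      { replace (r ^ 3) with (r ^ 2 * r) by ring. apply Rmult_le_compat_r; nra. }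
      assert (2 * gamma * r <= 2 * 1 * r) by (apply Rmult_le_compat_r; lra). lra.
    + intros k Hk. pose proof (window_bound p 2 k) as Hw.
      assert (3 <= INR k) by (change 3 with (IZR (Z.of_nat 3)); rewrite <- INR_IZR_INZ; now apply le_INR).
      pose proof (Cmod_ge_0 (A p k)). pose proof (Cmod_ge_0 (B 2 k)). nra.
  - intros eps z Heps Hz. set (D := fun k => (A p k + eps * B 2 k)%C).
    apply convex_bound_of_linear. intros e He.
    assert (HA : forall k, (k < 2)%nat -> D k = RtoC 0).
    { intros k Hk. unfold D, A, B. rewrite !window_out by lia. ring. }
    pose proof (Re_sum_wterm_ge e D z r (2 * gamma) p He Hz ltac:(lra) ltac:(lra) Hp
      (HA 0%nat ltac:(lia)) (HA 1%nat ltac:(lia))) as Hsum.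
    eapply Rle_trans; [|apply Rplus_le_compat_l, Hsum].
    2:{ intros k Hk. eapply Rle_trans; [|apply (window_bound p 2 k)].
        apply Rmult_le_compat_l; [apply pos_INR|]. unfold D.
        eapply Rle_trans; [apply Cmod_triangle|]. rewrite Cmod_mult, Heps. lra. }
    rewrite wterm_2, wterm_3. unfold D, A, B.
    rewrite !(window_in a), (window_in b), (window_out b) by lia.
    destruct (unit_part z r ltac:(lra) Hz) as [x [Hx ->]].
    destruct coeffs as [H1 [_ H3]].
    pose proof (H1 eps (2 * (3 + e) * RtoC r * x)%C (2 * (4 + 2 * e) * RtoC r ^ 2 * x ^ 2)%C
      (2 - 6 * r ^ 2 - 4 * tail4 r) Heps) as HT.
    specialize (HT ltac:(
      intros y Hy; pose proof (trig_bound_h r e (x * y) ltac:(lra) He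
        ltac:(rewrite Cmod_mult, Hx, Hy; ring)) as K;
      rewrite Cpow_mult_l, !Cmult_assoc in K; exact K)).
    replace (3 / 2 * Re (2 * (4 + 2 * e) * RtoC r ^ 2 * x ^ 2 * (a 3%nat + eps * b 3%nat))) with
      (Re (3 * (4 + 2 * e) * (RtoC r * x) ^ 2 * (a 3%nat + eps * 0))
       + Re ((4 + 2 * e) * (RtoC r * x) ^ 2 * (3 * eps * b 3%nat))) in HT.
    2:{ rewrite <- re_scal_l, <- re_plus. f_equal. rewrite RtoC_div by lra. field. }
    pose proof (re_le ((4 + 2 * e) * (RtoC r * x) ^ 2 * (3 * eps * b 3%nat))%C) as HB.
    specialize (H3 3%nat ltac:(lia)). simpl INR in H3.
    rewrite !Cmod_mult, Cmod_pow, Hz, Heps, Cmod_R, Rabs_pos_eq in HB by lra.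
    pose proof (Cmod_4_2e e He). pose proof (Cmod_ge_0 (b 3%nat)).
    (* Removing the b_3 that the section lacks costs at most this, balanced by the term 6 r^2 of the
       constant. *)
    assert (HB' : Cmod (4 + 2 * e) * r ^ 2 * (3 * 1 * Cmod (b 3%nat)) <= 6 * r ^ 2 * gamma).
    { apply Rmult_le_compat; [apply Rmult_le_pos; [apply Cmod_ge_0 | nra] | lra | | lra].
      apply Rmult_le_compat_r; [nra | assumption]. }
    replace (2 * (3 + e) * RtoC r * x * (a 2%nat + eps * b 2%nat))%C with
      (2 * (3 + e) * (RtoC r * x) * (a 2%nat + eps * b 2%nat))%C in HT by ring.
    lra.
Qed.

Lemma criterion_g_kap (q : nat) (r : R) : (3 <= q)%nat -> 0 < r < 1 ->
  2 * gamma * r + gamma / 3 * tail3 r < 1 ->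
  exists kap, 0 <= kap < 1 /\
     sum_n (fun k => INR k * (Cmod (A 2 k) + Cmod (B q k)) * r ^ pred k) q <= kap.
Proof.
  intros Hq Hr Hk. exists (2 * gamma * r + gamma / 3 * tail3 r).
  assert (HS : sum_n (fun k => INR k * (Cmod (A 2 k) + Cmod (B q k)) * r ^ pred k) q
    <= 2 * gamma * r + gamma / 3 * tail3 r).
  { apply sum_window_bound; [lra | lia | lra |].
    intros k Hk3. unfold A. rewrite window_out, Cmod_0 by lia.
    pose proof (window_bound_g q k).
    assert (3 <= INR k) by (change 3 with (IZR (Z.of_nat 3)); rewrite <- INR_IZR_INZ; now apply le_INR).
    pose proof (Cmod_ge_0 (B q k)). nra. }
  split; [split; [|exact Hk] | exact HS].
  eapply Rle_trans; [|exact HS]. apply sum_n_nonneg. intros k _.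
  apply Rmult_le_pos; [apply Rmult_le_pos; [apply pos_INR|] | apply pow_le; lra].
  pose proof (Cmod_ge_0 (A 2 k)). pose proof (Cmod_ge_0 (B q k)). lra.
Qed.

(** From order 4 on only b_k is left, with k |b_k| <= gamma, so the tail costs 2 gamma [tail4 r]. *)
Lemma criterion_g_linear (q : nat) (r : R) (eps z : C) : (3 <= q)%nat -> 0 < r < 1 ->
  Cmod eps = 1 -> Cmod z = r ->
  (forall e, Cmod e = 1 -> 2 * gamma * tail4 r <=
    2 + Re (2 * (3 + e) * z * (a 2%nat + eps * b 2%nat))
      + Re (3 * (4 + 2 * e) * z ^ 2 * (eps * b 3%nat))) ->
  Cmod (zddpoly (fun k => A 2 k + eps * B q k)%C q z) <=
  Re (2 * (1 + dpoly (fun k => A 2 k + eps * B q k) q z)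
      + zddpoly (fun k => A 2 k + eps * B q k) q z)%C.
Proof.
  intros Hq Hr Heps Hz Hlin. set (D := fun k => (A 2 k + eps * B q k)%C).
  apply convex_bound_of_linear. intros e He.
  assert (HA : forall k, (k < 2)%nat -> D k = RtoC 0).
  { intros k Hk. unfold D, A, B. rewrite !window_out by lia. ring. }
  pose proof (Re_sum_wterm_ge e D z r gamma q He Hz ltac:(lra) ltac:(lra) Hq
    (HA 0%nat ltac:(lia)) (HA 1%nat ltac:(lia))) as Hsum.
  eapply Rle_trans; [|apply Rplus_le_compat_l, Hsum].
  2:{ intros k Hk. unfold D, A. rewrite window_out, Cplus_0_l, Cmod_mult, Heps, Rmult_1_l by lia.
      apply window_bound_g. }
  rewrite wterm_2, wterm_3. unfold D, A, B.
  rewrite (window_in a), !(window_in b), (window_out a), Cplus_0_l by lia.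
  specialize (Hlin e He). lra.
Qed.

Lemma criterion_g_small (q : nat) (r : R) : (3 <= q)%nat -> 0 < r <= 23 / 100 ->
  convex_criterion (A 2) (B q) q r.
Proof.
  intros Hq Hr. split.
  - apply criterion_g_kap; [exact Hq | lra |].
    assert (Ht : tail4 r <= 559 / 100 * r ^ 3) by (apply tail4_le; nra).
    unfold tail4 in Ht. assert (tail3 r <= 3 * r ^ 2 + 559 / 100 * r ^ 3) by lra.
    assert (3 * r ^ 2 + 559 / 100 * r ^ 3 <= 1) by nra. nra.
  - intros eps z Heps Hz. apply criterion_g_linear with r; try assumption; [lra|].
    intros e He. destruct coeffs as [H1 [H2 _]].
    destruct (unit_part z r ltac:(lra) Hz) as [x [Hx Ez]].
    pose proof (H1 eps (2 * (3 + e) * RtoC r * x)%C ((4 + 2 * e) * RtoC r ^ 2 * x ^ 2)%C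
      (2 - 6 * r ^ 2 - 2 * tail4 r) Heps) as HT.
    specialize (HT ltac:(
      intros y Hy; pose proof (trig_bound_g r e (x * y) ltac:(lra) He
        ltac:(rewrite Cmod_mult, Hx, Hy; ring)) as K;
      rewrite Cpow_mult_l, !Cmult_assoc in K; exact K)).
    set (d := ((4 + 2 * e) * z ^ 2)%C).
    assert (Hd : Cmod d <= 6 * r ^ 2).
    { unfold d. rewrite Cmod_mult, Cmod_pow, Hz. pose proof (Cmod_4_2e e He).
      apply Rmult_le_compat_r; [nra | assumption]. }
    (* [Re (d y) >= Re (d s) / 2 - gamma |d|] for [y = 3 eps b_3] and
       [s = 3 (a_3 + eps b_3)], because [|s - y| + |y| <= 2 gamma]. *)
    assert (Hy : 3 * Re (d * (a 3%nat + eps * b 3%nat)) / 2 - gamma * Cmod d <=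
       3 * Re (d * (eps * b 3%nat))).
    { specialize (H2 3%nat ltac:(lia)). simpl INR in H2.
      rewrite Cmult_plus_distr_l, re_plus.
      pose proof (re_le (d * a 3%nat)) as K1. rewrite Cmod_mult in K1.
      pose proof (re_ge (d * (eps * b 3%nat))) as K2. rewrite !Cmod_mult, Heps in K2.
      pose proof (Cmod_ge_0 d). nra. }
    replace (3 * (4 + 2 * e) * z ^ 2 * (eps * b 3%nat))%C with
      (RtoC 3 * (d * (eps * b 3%nat)))%C by (unfold d; ring).
    replace ((4 + 2 * e) * RtoC r ^ 2 * x ^ 2 * (a 3%nat + eps * b 3%nat))%C with
      (d * (a 3%nat + eps * b 3%nat))%C in HT by (unfold d; rewrite Ez; ring).
    replace (2 * (3 + e) * RtoC r * x * (a 2%nat + eps * b 2%nat))%C with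
      (2 * (3 + e) * z * (a 2%nat + eps * b 2%nat))%C in HT by (rewrite Ez; ring).
    rewrite re_scal_l. nra.
Qed.

(** Bounding every term by its modulus leaves 2 - 2 gamma (4 r + 3 r^2 + [tail4 r]), and 3 r^2 +
    [tail4 r] is [tail3 r]. *)
Lemma criterion_g_coeff (q : nat) (r : R) : (3 <= q)%nat -> 0 < r < 1 ->
  gamma * (4 * r + tail3 r) <= 1 ->
  convex_criterion (A 2) (B q) q r.
Proof.
  intros Hq Hr Hc.
  pose proof (tail3_nonneg r ltac:(lra)) as H0.
  split.
  - apply criterion_g_kap; [exact Hq | lra | nra].
  - intros eps z Heps Hz. apply criterion_g_linear with r; try assumption.
    intros e He. destruct coeffs as [_ [H2 H3]].
    specialize (H2 2%nat ltac:(lia)). specialize (H3 3%nat ltac:(lia)). simpl INR in H2, H3.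
    pose proof (re_ge (2 * (3 + e) * z * (a 2%nat + eps * b 2%nat))%C) as K1.
    pose proof (re_ge (3 * (4 + 2 * e) * z ^ 2 * (eps * b 3%nat))%C) as K2.
    rewrite !Cmod_mult, Hz, !Cmod_R, !Rabs_pos_eq in K1 by lra.
    rewrite !Cmod_mult, Cmod_pow, Hz, Heps, !Cmod_R, !Rabs_pos_eq in K2 by lra.
    assert (L1 : Cmod (3 + e) <= 4).
    { eapply Rle_trans; [apply Cmod_triangle|]. rewrite Cmod_R, He, Rabs_pos_eq by lra. lra. }
    pose proof (Cmod_4_2e e He) as L2.
    assert (L3 : Cmod (a 2%nat + eps * b 2%nat) <= Cmod (a 2%nat) + Cmod (b 2%nat)).
    { eapply Rle_trans; [apply Cmod_triangle|]. rewrite Cmod_mult, Heps. lra. }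
    assert (M1 : 2 * Cmod (3 + e) * r * Cmod (a 2%nat + eps * b 2%nat) <= 2 * 4 * r * gamma).
    { apply Rmult_le_compat; [|apply Cmod_ge_0| |lra].
      - pose proof (Cmod_ge_0 (3 + e)). nra.
      - nra. }
    assert (M2 : 3 * Cmod (4 + 2 * e) * r ^ 2 * (1 * Cmod (b 3%nat)) <= 6 * r ^ 2 * gamma).
    { replace (3 * Cmod (4 + 2 * e) * r ^ 2 * (1 * Cmod (b 3%nat))) with
        ((Cmod (4 + 2 * e) * r ^ 2) * (3 * Cmod (b 3%nat))) by ring.
      pose proof (Cmod_ge_0 (4 + 2 * e)). pose proof (Cmod_ge_0 (b 3%nat)).
      apply Rmult_le_compat; [nra | lra | | lra].
      apply Rmult_le_compat_r; [nra | assumption]. }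
    unfold tail4. nra.
Qed.

End Criterion.

(** Any two points of the open disk lie in a smaller closed one, where the criterion applies. *)
Lemma convex_in_disk_of_criterion (a b : nat -> C) (p q n : nat) (rad : R) :
  (p <= n)%nat -> (q <= n)%nat -> 0 < rad ->
  (forall r, 0 < r < rad -> convex_criterion (window a 2 p) (window b 2 q) n r) ->
  convex_in_disk (s_pq a b p q) rad.
Proof.
  intros Hp Hq Hrad Hcrit.
  assert (Hmid : forall z w : C, Cmod z < rad -> Cmod w < rad ->
     exists r, 0 < r < rad /\ Cmod z <= r /\ Cmod w <= r).
  { intros z w Hz Hw. exists ((Rmax (Cmod z) (Cmod w) + rad) / 2).
    pose proof (Rmax_l (Cmod z) (Cmod w)). pose proof (Rmax_r (Cmod z) (Cmod w)).
    pose proof (Rmax_lub_lt _ _ _ Hz Hw). pose proof (Cmod_ge_0 z). lra. }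
  split.
  - intros z w Hz Hw E. rewrite !Defs_Cmod in *.
    destruct (Hmid z w Hz Hw) as [r [Hr [Hz' Hw']]].
    destruct (Hcrit r Hr) as [[kap [Hkap Hsum]] _].
    rewrite !(s_pq_hpoly a b p q n) in E by assumption.
    exact (hpoly_injective _ _ n r kap (proj2 Hkap) Hsum z w Hz' Hw' E).
  - intros z w Hz Hw t Ht. rewrite !Defs_Cmod in *.
    destruct (Hmid z w Hz Hw) as [r [Hr [Hz' Hw']]].
    destruct (hpoly_convex _ _ n r (proj1 Hr) (Hcrit r Hr) z w Hz' Hw' t Ht) as [u [Hu E]].
    exists u. rewrite Defs_Cmod. split; [lra|].
    rewrite !(s_pq_hpoly a b p q n) by assumption. rewrite E.
    apply C_ext; unfold Cadd, Cscal; simpl; ring.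
Qed.

(** [P2] is 1 at r = 0 and, being affine in beta, negative at 234/1000 for all beta considered. The
    constant rounds up the root for beta = 0, about 0.2338. *)
Lemma P2_root_le (beta R2 : R) : 0 <= beta < 1 -> smallest_root_01 (P2 beta) R2 ->
  R2 <= 234 / 1000.
Proof.
  intros Hb [HR [_ Hmin]].
  destruct (Rle_lt_dec R2 (234 / 1000)) as [H | H]; [exact H|]. exfalso.
  destruct (IVT (fun r => - P2 beta r) 0 (234 / 1000)) as [r [Hr E]].
  - intros x. apply derivable_continuous_pt. unfold P2.
    eexists. apply is_derive_Reals. auto_derive; [trivial | reflexivity].
  - lra.
  - unfold P2. lra.
  - unfold P2. lra.
  - assert (r <> 0) by (intros ->; unfold P2 in E; lra).
    apply (Hmin r); lra.
Qed.

(** As 1 - 4 r + 4 r^2 - r^4 = (1 - 2 r - r^2) (1 - r)^2, the equation can be solved for gamma = 1 -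
    beta. Since 4 r + [tail3 r] = r (4 - 5 r + 2 r^2) / (1 - r)^2, the claim becomes the polynomial
    inequality [Hp] in R1 alone. *)
Lemma P1_root_coeff (beta R1 : R) : 0 <= beta < 1 -> 23 / 100 < R1 < 1 -> P1 beta R1 = 0 ->
  (1 - beta) * (4 * R1 + tail3 R1) <= 1.
Proof.
  intros Hb HR E. set (g := 1 - beta).
  assert (Eg : g * (R1 ^ 2 * (6 + 8 * R1 - 2 * R1 ^ 2 - 4 * R1 ^ 3)) =
    (1 - 2 * R1 - R1 ^ 2) * (1 - R1) ^ 2).
  { unfold P1 in E. unfold g. lra. }
  assert (Hs : 0 < R1 * (6 + 8 * R1 - 2 * R1 ^ 2 - 4 * R1 ^ 3)) by (apply Rmult_lt_0_compat; nra).
  assert (Hp : (1 - 2 * R1 - R1 ^ 2) * (4 - 5 * R1 + 2 * R1 ^ 2) <=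
    R1 * (6 + 8 * R1 - 2 * R1 ^ 2 - 4 * R1 ^ 3)) by nra.
  assert (Hgoal : g * (R1 * (4 - 5 * R1 + 2 * R1 ^ 2)) <= (1 - R1) ^ 2).
  { apply Rmult_le_reg_r with (R1 * (6 + 8 * R1 - 2 * R1 ^ 2 - 4 * R1 ^ 3)); [exact Hs|].
    replace (g * (R1 * (4 - 5 * R1 + 2 * R1 ^ 2)) * (R1 * (6 + 8 * R1 - 2 * R1 ^ 2 - 4 * R1 ^ 3)))
      with (g * (R1 ^ 2 * (6 + 8 * R1 - 2 * R1 ^ 2 - 4 * R1 ^ 3)) * (4 - 5 * R1 + 2 * R1 ^ 2)) by ring.
    rewrite Eg.
    replace ((1 - 2 * R1 - R1 ^ 2) * (1 - R1) ^ 2 * (4 - 5 * R1 + 2 * R1 ^ 2)) with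
      ((1 - R1) ^ 2 * ((1 - 2 * R1 - R1 ^ 2) * (4 - 5 * R1 + 2 * R1 ^ 2))) by ring.
    apply Rmult_le_compat_l; [nra | exact Hp]. }
  unfold tail3.
  replace (g * (4 * R1 + (1 / (1 - R1) ^ 2 - 1 - 2 * R1))) with
    (g * (R1 * (4 - 5 * R1 + 2 * R1 ^ 2)) / (1 - R1) ^ 2) by (field; lra).
  apply Rle_div_l; [nra | lra].
Qed.

Theorem theorem5p2 :
  forall (alpha beta : R) (a b : nat -> Cx) (h g : Cx -> Cx),
    0 <= alpha -> 0 <= beta < 1 ->
    in_WH0 alpha beta a b h g ->
    (forall (q : nat) (R1 : R), (2 < q)%nat -> smallest_root_01 (P1 beta) R1 ->
       convex_in_disk (s_pq a b 2 q) R1) /\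
    (forall (p : nat) (R2 : R), (2 < p)%nat -> smallest_root_01 (P2 beta) R2 ->
       convex_in_disk (s_pq a b p 2) R2).
Proof.
  intros alpha beta a b h g Ha Hb Hf.
  pose proof (WH0_coefficient_estimates alpha beta a b h g Ha Hf) as Hc.
  assert (Hg : 0 < 1 - beta <= 1) by lra.
  split.
  - intros q R1 Hq [HR [Hroot _]].
    apply (convex_in_disk_of_criterion a b 2 q q R1); [lia | lia | lra |].
    (* A small root calls for the trigonometric polynomial; a larger one forces gamma to be
       small. *)
    intros r Hr. destruct (Rle_lt_dec R1 (23 / 100)) as [Hsmall | Hbig].
    + apply (criterion_g_small (1 - beta)); [assumption .. | lra].
    + apply (criterion_g_coeff (1 - beta)); [assumption .. | lra |].
      (* 4 r + [tail3 r] increases with r, so the bound at [R1] serves every smaller radius. *)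
      pose proof (P1_root_coeff beta R1 Hb ltac:(lra) Hroot).
      pose proof (tail3_incr r R1 ltac:(lra) ltac:(lra)). nra.
  - intros p R2 Hp Hroot. pose proof (P2_root_le beta R2 Hb Hroot).
    destruct Hroot as [HR _].
    apply (convex_in_disk_of_criterion a b p 2 p R2); [lia | lia | lra |].
    intros r Hr. apply (criterion_h (1 - beta)); [assumption .. | lra].
Qed.
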